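(* Let $\mathbb X$ be a finite set, $c\in\mathbb R^{\mathbb X}$, and $P=\Delta_{\mathbb X}\cap\mathcal L$ with $\mathcal L\subseteq\mathbb R^{\mathbb X}$ an affine space and $P\cap\mathbb R^{\mathbb X}_{>0}\neq\emptyset$. Assume that the linear program $\max c^\top\mu$ subject to $\mu\in P$ admits a unique solution $\mu^\star\in P$, and that $P\neq\{\mu^\star\}$. For $t>0$ let $\mu^\star_t$ denote the unique solution of the entropy-regularized linear program $$\max\ c^\top\mu+t^{-1}H(\mu)\quad\text{subject to }\mu\in P .$$ Let $\mu_0:=\arg\max_{\mu\in P}H(\mu)$ and $$\Delta := \min\left\{\frac{c^\top\mu^\star-c^\top\mu}{\lVert\mu^\star-\mu\rVert_{\mathrm{TV}}} : \mu\in N(\mu^\star)\right\},\qquad t_0:=\frac{2D_{\mathrm{KL}}(\mu^\star,\mu_0)}{\Delta\cdot\min\{\mu^\star_x:\mu^\star_x>0\}},$$ where $N(\mu^\star)$ is the set of neighboring vertices of $\mu^\star$ in $P$. Let $R_H:=\max_{\mu\in P}H(\mu)-\min_{\mu\in P}H(\mu)$. Then $R_H\le\log|\mathbb X|$, and for any $t\ge t_0$ we have $$D_{\mathrm{KL}}(\mu^\star,\mu^\star_t)\le R_H\exp\left(-\Delta(t-t_0)+2t_0\Delta\log\left(\frac{t+t_0}{2t_0}\right)\right)$$ as well as $$c^\top\mu^\star-c^\top\mu^\star_t\le\Delta R_H\exp\left(-\Delta(t-t_0)+2t_0\Delta\log\left(\frac{t+t_0}{2t_0}\right)\right).$$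
   Context: $\Delta_{\mathbb X}=\{\mu\in\mathbb R^{\mathbb X}_{\ge0}:\sum_x\mu_x=1\}$ is the probability simplex. $H(\mu)=-\sum_x\mu_x\log\mu_x$ is the Shannon entropy (with $0\log0=0$). Two vertices $\mu_1,\mu_2$ of a polytope $P\subseteq\mathbb R^{\mathbb X}$ are neighbors if the set $\{a\in\mathbb R^{\mathbb X}: a^\top\mu_1=a^\top\mu_2=\max_{\mu\in P}a^\top\mu\}$ has dimension $|\mathbb X|-1$ (i.e. they are distinct and joined by an edge of $P$). $\lVert v\rVert_{\mathrm{TV}}=\frac12\sum_x|v_x|$. For $\mu,\nu\in\Delta_{\mathbb X}$ with $\nu_x=0\Rightarrow\mu_x=0$, $D_{\mathrm{KL}}(\mu,\nu)=\sum_x\mu_x\log\frac{\mu_x}{\nu_x}$ (with $0\log\frac00=0$). *)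

(* Defs.v *)
From HB Require Import structures.
From mathcomp Require Import all_boot all_order all_algebra.
From mathcomp Require Import all_classical all_reals all_analysis.

Set Implicit Arguments.
Unset Strict Implicit.
Unset Printing Implicit Defensive.

Import Order.TTheory GRing.Theory Num.Theory.

Local Open Scope classical_set_scope.
Local Open Scope ring_scope.

(* R^o (R as a module over itself) makes this type a vectType over R,
   of dimension #|X|. *)
Notation vec R X := {ffun X -> R^o}.

Section Definitions.
Variables (R : realType) (X : finType).
Implicit Types (a c mu nu : vec R X) (P S L : set (vec R X)).

Definition dot a mu : R := \sum_x a x * mu x.

Definition simplex : set (vec R X) :=
  [set mu | (forall x, 0 <= mu x) /\ \sum_x mu x = 1].

Definition affine_space L : Prop :=
  exists (v : vec R X) (U : {vspace vec R X}), L = [set v + u | u in [set` U]].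

(* ln is total in the library, so 0 * ln 0 = 0 as in the convention 0 log 0 = 0. *)
Definition entropy mu : R := - \sum_x mu x * ln (mu x).

Definition tv_norm (v : vec R X) : R := 2^-1 * \sum_x `|v x|.

(* Meaningful only if mu x = 0 whenever nu x = 0; the terms with mu x = 0
   vanish. *)
Definition kl mu nu : R := \sum_x mu x * ln (mu x / nu x).

Definition argmax P (f : vec R X -> R) : set (vec R X) :=
  [set mu | P mu /\ forall nu, P nu -> f nu <= f mu].

(* V is the direction of the affine hull of S, that is, the least linear
   subspace containing all differences of elements of S. *)
Definition has_affine_dim S (d : nat) : Prop :=
  S !=set0 /\ exists V : {vspace vec R X},
    [/\ forall a b, S a -> S b -> a - b \in V,
        forall W : {vspace vec R X},
          (forall a b, S a -> S b -> a - b \in W) -> (V <= W)%VS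
      & \dim V = d].

(* A zero-dimensional face: mu is the unique maximizer over P of some linear
   functional. *)
Definition vertex P mu : Prop := exists a, argmax P (dot a) = [set mu].

Definition neighbors P mu : set (vec R X) :=
  [set nu | [/\ vertex P mu, vertex P nu &
    has_affine_dim
      [set a | argmax P (dot a) mu /\ argmax P (dot a) nu] #|X|.-1]].

(* The problem of maximizing entropy, and the regularized problem for t > 0,
   have exactly one solution when P is a nonempty compact convex subset of the
   simplex; 0 is a default value for the other cases. *)
Definition max_entropy_sol P : vec R X := xget 0 (argmax P entropy).

Definition reg_sol c P (t : R) : vec R X :=
  xget 0 (argmax P (fun mu => dot c mu + t^-1 * entropy mu)).

(* In the next three definitions sup and inf are a maximum and minima: the
   entropy is continuous on the compact set P, and the two other sets are
   finite and, in the case of interest, nonempty. *)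
Definition entropy_range P : R := sup (entropy @` P) - inf (entropy @` P).

Definition edge_gap c P mu : R :=
  inf [set (dot c mu - dot c nu) / tv_norm (mu - nu) | nu in neighbors P mu].

Definition min_positive_entry mu : R :=
  inf [set mu x | x in [set x | 0 < mu x]].

End Definitions.

(* Main.v *)
Require Import Defs.
From HB Require Import structures.
From mathcomp Require Import all_boot all_order all_algebra.
From mathcomp Require Import all_classical all_reals all_analysis.
From mathcomp Require Import ring lra.

Set Implicit Arguments.
Unset Strict Implicit.
Unset Printing Implicit Defensive.

Import Order.TTheory GRing.Theory Num.Theory.
Import numFieldNormedType.Exports.

Local Open Scope classical_set_scope.
Local Open Scope ring_scope.

(** Write [H] for the entropy, [gap mu] for [dot c mustar - dot c mu], and
    [mu_t] for the maximizer of [t * dot c mu + H mu] over [P], so that [mu_0] is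
    the point of maximal entropy.

    The polytope enters through two facts.  At the vertex [mustar] the tangent
    cone of [P] is generated by its extreme rays, and an extreme ray, followed
    until it leaves [P], ends at a neighbor of [mustar]; hence
    [Delta * tv_norm (mustar - mu) <= gap mu] on [P] ([gap_ge_tv]).  There are
    finitely many vertices, since a vertex is determined by its support, so
    [Delta > 0] ([edge_gap_gt0]).

    The path [mu_t] stays in the interior of the simplex, and its optimality
    condition is that [t * c - ln mu_t] is orthogonal to the directions of [P].
    This gives [kl nu mu_t = max - value at nu] for the objective at [t]
    ([opt_kl]), and from it three things:
    - [t * gap mu_t <= kl mustar mu_0]; for [t >= t0] this brings [mu_t] so close
      to [mustar] that [mu_t >= (1 - t0 / 2t) mustar] coordinatewise
      ([opt_ratio]);
    - [kl mustar mu_t] has derivative [- gap mu_t] ([opt_kl_step]);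
    - [gap mu_t] has derivative at most [- gap^2 / chi2], where [chi2] is
      [\sum_x (mustar x - mu_t x)^2 / mu_t x] (Cauchy-Schwarz,
      [opt_gap_step]).
    By the coordinatewise bound both [kl mustar mu_t] and [chi2] are at most
    [tv_norm (mustar - mu_t) / (1 - t0 / 2t)], hence at most
    [gap mu_t / (Delta * (1 - t0 / 2t))].  So both the divergence and the gap
    decay at rate at least [Delta * (1 - t0 / 2t)], which is larger than
    [Delta * (t - t0) / (t + t0)], the rate of the claimed bound.  This strict
    inequality of rates lets a continuity argument ([continuous_induction])
    replace differentiation.

    It remains to compare at [t = t0].  There
    [kl mustar mu_t <= kl mustar mu_0 <= RH].  The bound [gap mu_t <= Delta * RH]
    is more delicate: by the definition of [t0] it amounts to
    [m * (t * gap mu_t) <= 2 * kl mustar mu_0 * RH], with [m] the smallest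
    positive entry of [mustar], and holds for every [t]
    ([opt_gap_entropy_range]).  One prolongs the segment from [mustar] to [mu_t]
    up to the boundary of [P], where some positive coordinate of [mustar] has
    vanished.  The entropy is so concave in that coordinate that a large value of
    [t * gap mu_t], which is the directional derivative of [H] at [mu_t] scaled
    by the distance from [mustar], forces a large range of [H] on this segment. *)


(** * Real inequalities about the logarithm *)

Section Scalar.
Variable R : realType.
Implicit Types a b p q s th w y z : R.

Lemma ln_le_sub1 z : 0 < z -> ln z <= z - 1.
Proof.
move=> z0; have -> : z = 1 + (z - 1) by ring.
have := @le_ln1Dx R (z - 1); lra.
Qed.

(** The constant 8 is what [ray_tradeoff_unit] needs, so [e < 3] would be too
    weak; the bound [e <= (20/19)^20] comes from [1 - 1/20 <= exp (- 1/20)]. *)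
Lemma expR1_sqr_le8 : (expR 1 : R) ^+ 2 <= 8.
Proof.
have h : expR 1 * (19 / 20) ^+ 20 <= (1 : R).
  rewrite [leRHS](_ : 1 = expR 1 * expR (20%:R * (- (1 / 20)))); last first.
    by rewrite -expRD -[LHS]expR0; congr expR; field.
  rewrite ler_pM2l ?expR_gt0// expRM_natl lerXn2r ?nnegrE ?expR_ge0//;
  have := expR_ge1Dx (- (1 / 20) : R); lra.
have e0 := expR_gt0 (1 : R).
have : (expR 1 : R) <= 14 / 5.
  rewrite -[leLHS]mulr1 -ler_pdivlMl//.
  have : 1 / expR 1 >= (19 / 20 : R) ^+ 20 by rewrite ler_pdivlMr// mulrC.
  by rewrite mul1r; lra.
nra.
Qed.

(** The tangent inequality behind every use of relative entropy below: summed
    over the coordinates of two vectors of equal mass it is Gibbs' inequality. *)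
Lemma relent_ge a b : 0 <= a -> 0 < b -> a - b <= a * ln (a / b).
Proof.
rewrite le_eqVlt => /predU1P[<- b0|a0 b0]; first by rewrite !mul0r; lra.
have ab : 0 < a / b by rewrite divr_gt0.
have := @ln_le_sub1 (b / a) (divr_gt0 b0 a0).
rewrite -invf_div lnV ?posrE// -(ler_pM2l a0) mulrN mulrBr mulr1 invf_div.
by rewrite mulrCA divff ?gt_eqF// mulr1; lra.
Qed.

Lemma relent_le a b : 0 <= a -> 0 < b -> a * ln (a / b) <= a * (a / b - 1).
Proof.
rewrite le_eqVlt => /predU1P[<- b0|a0 b0]; first by rewrite !mul0r.
by rewrite ler_pM2l// ln_le_sub1// divr_gt0.
Qed.

Lemma xlnx_convex q a b : 0 <= q <= 1 -> 0 <= a -> 0 <= b ->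
  (q * a + (1 - q) * b) * ln (q * a + (1 - q) * b) <=
  q * (a * ln a) + (1 - q) * (b * ln b).
Proof.
move=> /andP[q0 q1] a0 b0; pose m := q * a + (1 - q) * b; rewrite -/m.
have tangent z : 0 <= z -> 0 < m -> z * ln m + z - m <= z * ln z.
  rewrite le_eqVlt => /predU1P[<- m0|z0 m0]; first by rewrite !mul0r; lra.
  by have := relent_ge (ltW z0) m0; rewrite ln_div ?posrE//; lra.
have : 0 <= m by rewrite /m; nra.
rewrite [0 <= m]le_eqVlt => /predU1P[m0|m0]; last first.
  have := tangent a a0 m0; have := tangent b b0 m0.
  move: (ln m) (ln a) (ln b) => lm la lb h1 h2.
  have : q * (a * lm + a - m) <= q * (a * la) by rewrite ler_wpM2l.
  have : (1 - q) * (b * lm + b - m) <= (1 - q) * (b * lb).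
    by rewrite ler_wpM2l// subr_ge0.
  rewrite /m; lra.
rewrite -m0 mul0r.
have qa : q * a = 0 by move: m0; rewrite /m; nra.
have qb : (1 - q) * b = 0 by move: m0; rewrite /m; nra.
by rewrite !mulrA qa qb !mul0r addr0.
Qed.

(** Since [b - a] is [ln b - ln a] times the logarithmic mean of [a] and [b], which
    is at least their minimum. *)
Lemma mul_diff_ln_ge w a b : 0 < w -> w <= a -> w <= b ->
  w * (ln b - ln a) ^+ 2 <= (b - a) * (ln b - ln a).
Proof.
move=> w0; wlog ab : a b / a <= b => [H wa wb|wa wb].
  have [/H|/ltW/H] := leP a b; first exact.
  by move=> /(_ wb wa); rewrite -(sqrrN (_ - _)) opprB; lra.
have a0 : 0 < a by lra.
have b0 : 0 < b by lra.
have h1 : 0 <= ln b - ln a by rewrite subr_ge0 ler_ln.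
rewrite expr2 mulrA ler_wpM2r//.
have := relent_ge (ltW a0) b0; rewrite ln_div ?posrE// => h.
have : w * (ln b - ln a) <= a * (ln b - ln a) by rewrite ler_wpM2r.
lra.
Qed.

(** The logarithm has slope at least 1 on ]0, 1]. *)
Lemma sqr_diff_le_diff_ln a b : 0 < a <= 1 -> 0 < b <= 1 ->
  (b - a) ^+ 2 <= (b - a) * (ln b - ln a).
Proof.
wlog ab : a b / a <= b => [H ha hb|/andP[a0 a1] /andP[b0 b1]].
  have [/H|/ltW/H] := leP a b; first exact.
  by move=> /(_ hb ha); rewrite -(sqrrN (_ - _)) opprB; lra.
rewrite expr2 ler_wpM2l ?subr_ge0//.
have := relent_ge (ltW b0) a0; rewrite ln_div ?posrE// => h.
have : 0 <= ln b - ln a by rewrite subr_ge0 ler_ln.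
nra.
Qed.

(** The left side is [p * (p - q) / q - (p - q)], whose first term is nonpositive
    for [p <= q] and at most [(p - q) / th] otherwise.  In a sum over vectors of
    equal mass the terms [p - q] cancel and the positive parts add up to the
    total variation. *)
Lemma chi2_term th p q : 0 < th -> 0 <= p -> 0 < q -> th * p <= q ->
  (p - q) ^+ 2 / q <= 2^-1 * (`|p - q| + (p - q)) / th - (p - q).
Proof.
move=> th0 p0 q0 pq.
have -> : (p - q) ^+ 2 / q = p * (p - q) / q - (p - q).
  by field; rewrite gt_eqF.
rewrite lerD2r ler_pdivrMr// mulrAC ler_pdivlMr//.
have [h|h] := leP 0 (p - q).
  rewrite ger0_norm//; have -> : 2^-1 * (p - q + (p - q)) * q = (p - q) * q by field.
  have -> : p * (p - q) * th = (p - q) * (th * p) by ring.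
  by rewrite ler_wpM2l.
rewrite ltr0_norm//; have -> : 2^-1 * (- (p - q) + (p - q)) * q = 0 by ring.
have : p * (p - q) <= 0 by rewrite mulr_ge0_le0 // ltW.
move: (p * _) => r; nra.
Qed.

(** The one-dimensional inequality behind [opt_gap_entropy_range].  On a ray that
    starts at an optimal vertex, [s] is the fraction left of a coordinate when
    the current point is reached, [y] the scaled slope of the entropy there, [g]
    the entropy gained since the vertex, [K] the entropy that can be gained in
    total, and [Q] the entropy range.  The hypothesis on [q] compares the total
    gain with the points between the current one and the end of the ray. *)
Lemma ray_tradeoff_unit y g K Q s : 0 < s <= 1 -> K <= Q -> g <= K ->
  y + (- ln s - (1 - s)) <= g ->
  (forall q, 0 < q <= 1 -> g <= K + (q^-1 - 1) * Q + s * ln q) -> 0 <= K ->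
  y <= 2 * K * Q.
Proof.
move=> /andP[s0 s1] KQ gK yg chord K0.
have lns := ln_le_sub1 s0.
have [Q2|Q2] := leP (1 / 2) Q; first nra.
have e8 := expR1_sqr_le8.
have e0 : 0 < (expR 1 : R) by exact: expR_gt0.
have e1 : ln (expR 1 : R) = 1 by rewrite expRK.
set e : R := expR 1 in e8 e0 e1.
have KQ2 : K - 2 * K * Q <= Q - 2 * Q ^+ 2 by nra.
have [es|es] := leP 1 (e * s).
  have es0 : 0 < e * s by lra.
  (* this q makes the bound quadratic in s, with maximum e^2 Q^2 / 4 <= 2 Q^2 *)
  have := chord (e * s)^-1; rewrite invr_gt0 es0 invf_le1// es => /(_ isT).
  rewrite invrK lnV ?posrE// lnM ?posrE// e1 => h.
  have : (1 - s) * ln s <= (1 - s) * (s - 1) by rewrite ler_wpM2l; lra.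
  have : 0 <= (s - e * Q / 2) ^+ 2 by exact: sqr_ge0.
  have : 0 <= (8 - e ^+ 2) * Q ^+ 2 by rewrite mulr_ge0 ?sqr_ge0//; lra.
  nra.
have := @ln_le_sub1 (e * s); rewrite mulr_gt0// => /(_ isT).
rewrite lnM ?posrE// e1 => h.
have e3 : e <= 3 by nra.
have e2 : 2 <= e by have := expR_ge1Dx (1 : R); rewrite -/e; lra.
have : Q - 2 * Q ^+ 2 <= 1 / 8 by have := sqr_ge0 (Q - 1 / 4); nra.
have : ln s + 1 - s <= - (1 / 8).
  suff : (e - 1) * s <= 7 / 8 by lra.
  by nra.
by lra.
Qed.

(** The same for a coordinate that is [p] at the vertex; all quantities scale. *)
Lemma ray_tradeoff p y g K Q s : 0 < p -> 0 < s <= 1 -> K <= Q -> g <= K ->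
  y + p * (- ln s - (1 - s)) <= g ->
  (forall q, 0 < q <= 1 -> g <= K + (q^-1 - 1) * Q + p * s * ln q) -> 0 <= K ->
  p * y <= 2 * K * Q.
Proof.
move=> p0 s01 KQ gK yg chord K0.
have pn : p != 0 by rewrite gt_eqF.
have := @ray_tradeoff_unit (y / p) (g / p) (K / p) (Q / p) s s01.
rewrite !ler_pdivrMr// !divfK// mulr_ge0 ?invr_ge0 ?(ltW p0)//.
move=> /(_ KQ gK) H.
have /H : y / p + (- ln s - (1 - s)) <= g / p.
  by rewrite ler_pdivlMr// mulrDl divfK//; lra.
move=> H2.
have -> : 2 * K * Q = p * (2 * (K / p) * (Q / p) * p).
  by field.
rewrite ler_pM2l//; apply: H2 => // q q01.
rewrite ler_pdivrMr// (_ : (_ + _) * p = K + (q^-1 - 1) * Q + p * s * ln q).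
  exact: chord.
by field; rewrite pn gt_eqF//; case/andP: q01.
Qed.

End Scalar.

(** * Entropy, divergence and total variation of finite vectors *)

Section Vectors.
Variables (R : realType) (X : finType).
Implicit Types (a b u v w mu nu : vec R X) (t q : R) (x : X).

Lemma dotDr a u v : dot a (u + v) = dot a u + dot a v.
Proof. by rewrite /dot -big_split; apply: eq_bigr => x _; rewrite ffunE mulrDr. Qed.

Lemma dotZr a q u : dot a (q *: u) = q * dot a u.
Proof. by rewrite /dot mulr_sumr; apply: eq_bigr => x _; rewrite ffunE mulrCA. Qed.

Lemma dotC a u : dot a u = dot u a.
Proof. by apply: eq_bigr => x _; rewrite mulrC. Qed.

Lemma dotNr a u : dot a (- u) = - dot a u.
Proof. by rewrite -scaleN1r dotZr mulN1r. Qed.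

Lemma dotBr a u v : dot a (u - v) = dot a u - dot a v.
Proof. by rewrite dotDr dotNr. Qed.

Lemma dot0r a : dot a 0 = 0.
Proof. by rewrite -(scale0r (0 : vec R X)) dotZr mul0r. Qed.

Lemma vecBE u v x : (u - v) x = (u x : R) - v x.
Proof. by rewrite !ffunE. Qed.

Lemma dot0l u : dot 0 u = 0.
Proof. by rewrite dotC dot0r. Qed.

Lemma dotNl a u : dot (- a) u = - dot a u.
Proof. by rewrite dotC dotNr dotC. Qed.

Lemma tv_normE u : tv_norm u = 2^-1 * \sum_x `|u x : R|.
Proof. by []. Qed.

Lemma tv_normZ q u : 0 <= q -> tv_norm (q *: u) = q * tv_norm u.
Proof.
move=> q0; rewrite !tv_normE mulrCA [in RHS]mulr_sumr; congr (_ * _).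
by apply: eq_bigr => x _; rewrite ffunE -[_ *: _]/(q * _) normrM ger0_norm.
Qed.

Lemma tv_normD u v : tv_norm (u + v) <= tv_norm u + tv_norm v.
Proof.
rewrite !tv_normE -mulrDr ler_wpM2l// -big_split/=; apply: ler_sum => x _.
by rewrite ffunE ler_normD.
Qed.

Lemma tv_normN u : tv_norm (- u) = tv_norm u.
Proof.
by rewrite !tv_normE; congr (_ * _); apply: eq_bigr => x _; rewrite ffunE normrN.
Qed.

Lemma tv_norm_gt0 u : u != 0 -> 0 < tv_norm u.
Proof.
move=> u0; rewrite tv_normE pmulr_rgt0// lt_neqAle sumr_ge0// andbT eq_sym.
apply: contra u0 => s0; apply/eqP/ffunP => x; rewrite ffunE; apply/eqP.
rewrite -normr_eq0; move: s0; rewrite psumr_eq0// => /allP.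
by move=> /(_ x (mem_index_enum x)).
Qed.

Lemma sumB_eq0 a b : \sum_x (a x : R) = \sum_x (b x : R) -> \sum_x ((a x : R) - (b x : R)) = 0.
Proof. by move=> ab; rewrite sumrB ab subrr. Qed.

(** All the terms [a ln (a / b) - a + b] are nonnegative, and they sum to
    [kl a b]. *)
Lemma kl_ge_term a b y : (forall x, 0 <= a x) -> (forall x, 0 < b x) ->
  \sum_x (a x : R) = \sum_x (b x : R) ->
  (a y : R) * ln (a y / b y) - ((a y : R) - (b y : R)) <= kl a b.
Proof.
move=> a0 b0 ab; rewrite -[kl a b]subr0 -[X in kl a b - X](sumB_eq0 ab) /kl -sumrB (bigD1 y)//=.
rewrite lerDl; apply: sumr_ge0 => x _; rewrite subr_ge0; exact: relent_ge.
Qed.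

Lemma kl_ge0 a b : (forall x, 0 <= a x) -> (forall x, 0 < b x) ->
  \sum_x (a x : R) = \sum_x (b x : R) -> 0 <= kl a b.
Proof.
move=> a0 b0 ab; rewrite -[leRHS]subr0 -[X in _ - X](sumB_eq0 ab) /kl -sumrB.
by apply: sumr_ge0 => x _; rewrite subr_ge0; exact: relent_ge.
Qed.

Lemma chi2_le_tv (th : R) a b : 0 < th -> (forall x, 0 <= a x) ->
  (forall x, 0 < b x) -> (forall x, th * a x <= b x) ->
  \sum_x (a x : R) = \sum_x (b x : R) ->
  \sum_x ((a x : R) - (b x : R)) ^+ 2 / b x <= tv_norm (a - b) / th.
Proof.
move=> th0 a0 b0 ab sab.
rewrite -[leRHS]addr0 -[X in _ + X](sumB_eq0 sab) tv_normE.
have -> : 2^-1 * (\sum_x `|(a - b) x : R|) / th + \sum_x ((a x : R) - (b x : R)) =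
          \sum_x (2^-1 * (`|(a x : R) - b x| + ((a x : R) - (b x : R))) / th) - \sum_x ((a x : R) - (b x : R)).
  rewrite (sumB_eq0 sab) subr0 addr0 -mulr_suml -mulr_sumr big_split/= sumB_eq0//.
  by rewrite addr0; congr (_ * _ / _); apply: eq_bigr => x _; rewrite !ffunE.
rewrite -sumrB; apply: ler_sum => x _.
exact: chi2_term.
Qed.

Lemma kl_le_chi2 a b : (forall x, 0 <= a x) -> (forall x, 0 < b x) ->
  \sum_x (a x : R) = \sum_x (b x : R) -> kl a b <= \sum_x ((a x : R) - (b x : R)) ^+ 2 / b x.
Proof.
move=> a0 b0 sab; rewrite -[leLHS]subr0 -[X in _ - X](sumB_eq0 sab) /kl -sumrB.
apply: ler_sum => x _; have bn : b x != 0 by rewrite gt_eqF.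
apply: (@le_trans _ _ ((a x : R) * (a x / b x - 1) - ((a x : R) - (b x : R)))).
  by rewrite lerD2r; exact: relent_le.
by rewrite le_eqVlt; apply/orP; left; apply/eqP; field.
Qed.

(** In a vector of sum 0 each coordinate is balanced by all the others. *)
Lemma coord_le_tv u y : \sum_x (u x : R) = 0 -> `|u y : R| <= tv_norm u.
Proof.
move=> u0; rewrite tv_normE ler_pdivlMl//.
have -> : 2 * `|u y : R| = `|u y : R| + `|- u y : R| by rewrite normrN; ring.
rewrite (bigD1 y)//= lerD2l.
have <- : \sum_(x | x != y) (u x : R) = - u y.
  by move: u0; rewrite (bigD1 y)//= => /eqP; rewrite addrC addr_eq0 => /eqP.
exact: ler_norm_sum.
Qed.

(** Writing [H b - H a] with the divergence and a linear form isolates the first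
    order term of the entropy at [b]. *)
Lemma entropy_sub a b : (forall x, 0 <= a x) -> (forall x, 0 < b x) ->
  entropy b - entropy a = kl a b + \sum_x ((a x : R) - (b x : R)) * ln (b x).
Proof.
move=> a0 b0; rewrite /entropy /kl opprK addrC -sumrB -big_split/=.
apply: eq_bigr => x _.
have := a0 x; rewrite le_eqVlt => /predU1P[<-|ax]; first by rewrite !mul0r; ring.
by rewrite ln_div ?posrE//; ring.
Qed.

(** Concavity of the entropy, sharpened at a coordinate where [b] vanishes: there
    the mixture is [q * a y], and the gain over the chord is exactly
    [- q * a y * ln q]. *)
Lemma entropy_mix a b q y : (forall x, 0 <= a x) -> (forall x, 0 <= b x) ->
  0 < q <= 1 -> b y = 0 ->
  q * entropy a + (1 - q) * entropy b - q * (a y : R) * ln q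
  <= entropy (q *: a + (1 - q) *: b).
Proof.
move=> a0 b0 /andP[q0 q1] by0.
rewrite /entropy 2!mulrN -2!opprD lerN2 !mulr_sumr -big_split/=.
rewrite (bigD1 y)//= [leRHS](_ : _ = q * ((a y : R) * ln (a y)) +
  (1 - q) * ((b y : R) * ln (b y)) + q * (a y : R) * ln q +
  \sum_(x | x != y) (q * ((a x : R) * ln (a x)) + (1 - q) * ((b x : R) * ln (b x)))); last first.
  by rewrite (bigD1 y)//=; ring.
apply: lerD.
  rewrite !ffunE /= by0 scaler0 addr0 mul0r mulr0 addr0.
  have := a0 y; rewrite le_eqVlt => /predU1P[<-|ay].
    by rewrite scaler0 !(mul0r, mulr0) addr0.
  by rewrite lnM ?posrE// -[q *: _]/(q * _); lra.
apply: ler_sum => x _; rewrite !ffunE; apply: xlnx_convex => //.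
by rewrite ltW.
Qed.

Lemma simplex_le1 mu x : simplex mu -> mu x <= 1.
Proof.
move=> [mu0 <-]; rewrite (bigD1 x)//= lerDl; exact: sumr_ge0.
Qed.

Lemma entropy_ge0 mu : simplex mu -> 0 <= entropy mu.
Proof.
move=> smu; rewrite /entropy oppr_ge0; apply: sumr_le0 => x _.
have mu0 := smu.1 x.
by rewrite mulr_ge0_le0// ln_le0// simplex_le1.
Qed.

(** Gibbs' inequality against the uniform distribution. *)
Lemma entropy_le_lncard mu : simplex mu -> entropy mu <= ln #|X|%:R.
Proof.
move=> [mu0 mu1].
have n0 : 0 < #|X|%:R :> R.
  rewrite ltr0n; apply/card_gt0P; apply/existsP; apply: contraPT mu1.
  rewrite negb_exists => /forallP /= X0; rewrite big1 => [/eqP|x _].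
    by rewrite eq_sym oner_eq0.
  by have := X0 x.
rewrite -subr_ge0 /entropy opprK -[ln _]mul1r -mu1 mulr_suml -big_split/=.
pose b : vec R X := [ffun=> #|X|%:R^-1].
have sb : \sum_x (b x : R) = 1.
  rewrite (eq_bigr (fun=> #|X|%:R^-1 : R)) => [|x _]; last by rewrite ffunE.
  by rewrite sumr_const -[LHS]mulr_natl divff// gt_eqF.
have := @kl_ge0 mu b mu0; rewrite sb mu1 /kl => /(_ _ erefl) h.
apply: le_trans (h _) _ => [x|]; first by rewrite ffunE invr_gt0.
apply: ler_sum => x _; rewrite ffunE invrK.
have := mu0 x; rewrite le_eqVlt => /predU1P[<-|m0]; first by rewrite !mul0r addr0.
by rewrite lnM ?posrE// -mulrDr addrC.
Qed.

End Vectors.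

(** * Finite minima, orthogonality and separation *)

Section Linear.
Variables (R : realType) (X : finType).
Implicit Types (a b u v w mu nu : vec R X) (U V W : {vspace vec R X}) (x : X).

Lemma exists_argmin (I : finType) (p : pred I) (f : I -> R) i0 : p i0 ->
  exists2 i, p i & forall j, p j -> f i <= f j.
Proof. by move=> pi0; case: (arg_minP f pi0) => i pi fi; exists i. Qed.

Lemma exists_pos_lower_bound (I : finType) (p : pred I) (f : I -> R) :
  (forall i, p i -> 0 < f i) -> exists2 e, 0 < e & forall i, p i -> e <= f i.
Proof.
move=> f0; have [i0 pi0|p0] := pickP p; last by exists 1 => // i; rewrite p0.
by have [i pi fi] := exists_argmin f pi0; exists (f i) => //; exact: f0.
Qed.

Definition unitv x : vec R X := [ffun y => (y == x)%:R : R^o].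

Lemma dot_unitv x u : dot (unitv x) u = u x.
Proof.
rewrite /dot (bigD1 x)//= ffunE eqxx mul1r big1 ?addr0// => y yx.
by rewrite ffunE (negPf yx) mul0r.
Qed.

Lemma vec_sum_unitv u : u = \sum_x u x *: unitv x.
Proof.
apply/ffunP => y; rewrite sum_ffunE (bigD1 y)//= big1 => [|x xy].
  by rewrite addr0 !ffunE eqxx [_ *: _]mulr1.
by rewrite !ffunE eq_sym (negPf xy) scaler0.
Qed.

(** Valued in [R^o] so that it can be a linear map between vector spaces. *)
Definition dot_form a : vec R X -> R^o := dot a.

Fact dot_form_linear a : linear (dot_form a).
Proof. by move=> k u v; rewrite /dot_form dotDr dotZr. Qed.

HB.instance Definition _ a :=
  GRing.isLinear.Build R (vec R X) R^o _ (dot_form a) (dot_form_linear a).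

Definition orth a : {vspace vec R X} := lker (linfun (dot_form a)).

Lemma mem_orth a u : (u \in orth a) = (dot a u == 0).
Proof. by rewrite memv_ker lfunE. Qed.

Lemma dot_self_eq0 u : dot u u = 0 -> u = 0.
Proof.
move=> u0; apply/ffunP => x; rewrite ffunE; apply/eqP.
have : (u x : R) * u x == 0.
  rewrite eq_le -{1}u0 -expr2 sqr_ge0 andbT /dot (bigD1 x)//= -expr2 lerDl.
  by apply: sumr_ge0 => y _; rewrite -expr2 sqr_ge0.
by rewrite mulf_eq0 => /orP[].
Qed.

Lemma dimv_full : \dim {:vec R X} = #|X|.
Proof. by rewrite dimvf /dim/= muln1. Qed.

Lemma dim_orth u : u != 0 -> \dim (orth u) = #|X|.-1.
Proof.
move=> u0; have := limg_ker_dim (linfun (dot_form u)) fullv.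
rewrite capfv dimv_full => <-.
suff -> : \dim (limg (linfun (dot_form u))) = 1%N by rewrite addn1.
apply/eqP; rewrite eqn_leq; apply/andP; split.
  by apply: leq_trans (dimvS (subvf _)) _; rewrite dimvf.
rewrite lt0n dimv_eq0; apply: contra u0 => /eqP l0.
have : linfun (dot_form u) u \in limg (linfun (dot_form u)).
  by rewrite memv_img// memvf.
by rewrite l0 memv0 lfunE => /eqP /dot_self_eq0 ->.
Qed.

(** The coordinates of [v - projv U v] are linear forms in [v] that vanish on [U],
    and one of them is nonzero at [v] when [v] lies outside of [U]. *)
Lemma separation U v : v \notin U ->
  exists2 b, (forall u, u \in U -> dot b u = 0) & dot b v <> 0.
Proof.
move=> vU; have vpv : v - projv U v <> 0.
  by move/eqP; rewrite subr_eq0 => /eqP vE; move: vU; rewrite vE memv_proj.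
apply: contrapT => nex; apply: vpv.
apply/ffunP => x; apply: contrapT => vx; apply: nex.
pose f (y : vec R X) : R := (y - projv U y) x.
pose b : vec R X := [ffun z => f (unitv z)].
have fb y : dot b y = f y.
  rewrite {2}(vec_sum_unitv y) /f linear_sum -sumrB sum_ffunE.
  apply: eq_bigr => z _; rewrite !ffunE linearZ/= !ffunE -scalerBr.
  by rewrite /f !ffunE mulrC.
exists b => [u uU|]; rewrite fb /f; first by rewrite projv_id// subrr ffunE.
by move=> h; apply: vx; rewrite h ffunE.
Qed.

End Linear.

(** * Tangent cone and edges at the optimal vertex *)

Section Polytope.
Variables (R : realType) (X : finType).
Variables (c : vec R X) (P : set (vec R X)) (U : {vspace vec R X}).
Variable ms : vec R X.
Implicit Types (a b u v w mu nu : vec R X) (V W : {vspace vec R X}) (x : X).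

(* [simplex_affine_standard] provides such a space of directions *)
Hypothesis PE : forall mu nu, P mu ->
  P nu <-> (forall x, 0 <= nu x) /\ nu - mu \in U.
Hypothesis U_sum0 : forall u, u \in U -> \sum_x (u x : R) = 0.
Hypothesis msP : P ms.
Hypothesis ms_max : forall nu, P nu -> dot c nu <= dot c ms.
Hypothesis ms_uniq : forall nu, P nu -> dot c nu = dot c ms -> nu = ms.

Lemma P_ge0 mu x : P mu -> 0 <= mu x.
Proof. by move=> /[dup] Pmu /(PE _ Pmu)[]. Qed.

Lemma P_subU mu nu : P mu -> P nu -> nu - mu \in U.
Proof. by move=> Pmu /(PE _ Pmu)[]. Qed.

Lemma P_move mu w : P mu -> w \in U -> (forall x, 0 <= (mu x : R) + w x) ->
  P (mu + w).
Proof.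
move=> Pmu wU h; apply/(PE _ Pmu); split=> [x|]; first by rewrite ffunE.
by rewrite addrC addKr.
Qed.

Lemma P_step mu w : P mu -> w \in U -> (forall x, mu x = 0 -> 0 <= w x) ->
  exists2 e : R, 0 < e & P (mu + e *: w).
Proof.
move=> Pmu wU w0.
have [|m m0 mle] := @exists_pos_lower_bound R X [pred x | mu x != 0] (fun x => mu x).
  by move=> x /= mx; rewrite lt_neqAle eq_sym mx P_ge0.
pose s : R := 1 + \sum_x `|w x : R|.
have s0 : 0 < s by rewrite ltr_pwDl// sumr_ge0.
exists (m / s); first by rewrite divr_gt0.
apply: P_move => // [|x]; first exact: memvZ.
rewrite ffunE -[_ *: _]/(m / s * (w x : R)).
have [mx|mx] := eqVneq (mu x) 0.
  rewrite mx add0r; apply: mulr_ge0; last exact: w0.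
  by rewrite divr_ge0 ?ltW.
have := mle x mx; suff : - m <= m / s * (w x : R) by lra.
rewrite -mulrA -[X in - X]mulr1 -mulrN ler_pM2l//.
rewrite ler_pdivlMl// mulrN1 lerNl.
apply: (@le_trans _ _ `|w x : R|); first by rewrite -normrN ler_norm.
by rewrite /s (bigD1 x)//= addrCA lerDl addr_ge0// sumr_ge0.
Qed.

(** From a vertex one can move a little in both directions along [mu - nu], so its
    linear functional is constant on the segment and [nu] is optimal too. *)
Lemma vertex_support mu nu : vertex P mu -> P nu ->
  (forall x, mu x = 0 -> nu x = 0) -> nu = mu.
Proof.
move=> [a Ha] Pnu supp.
have [Pmu mu_max] : argmax P (dot a) mu by rewrite Ha.
suff : argmax P (dot a) nu by rewrite Ha.
split=> // la Pla; apply: (le_trans (mu_max _ Pla)).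
have [||e e0 Pe] := @P_step mu (mu - nu) Pmu.
- by rewrite -opprB rpredN P_subU.
- by move=> x mx; rewrite !ffunE mx supp// subrr.
have := mu_max _ Pe; rewrite dotDr dotZr dotBr gerDl pmulr_rle0//; lra.
Qed.

Definition tangent : set (vec R X) :=
  [set w | w \in U /\ forall x, ms x = 0 -> 0 <= w x].

Lemma tangent_sub mu : P mu -> tangent (mu - ms).
Proof.
move=> Pmu; split=> [|x mx]; first exact: P_subU.
by rewrite !ffunE mx subr0 P_ge0.
Qed.

Lemma tangentZ (k : R) u : 0 <= k -> tangent u -> tangent (k *: u).
Proof.
move=> k0 [uU u0]; split=> [|x mx]; first exact: memvZ.
by rewrite ffunE mulr_ge0// u0.
Qed.

(** Uniqueness of the optimum makes [c] strictly negative on the tangent cone; in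
    particular the cone contains no line. *)
Lemma tangent_dot_lt0 w : tangent w -> w != 0 -> dot c w < 0.
Proof.
move=> [wU w0] wn0.
have [e e0 Pe] := P_step msP wU w0.
rewrite lt_neqAle; apply/andP; split; last first.
  by have := ms_max Pe; rewrite dotDr dotZr gerDl pmulr_rle0.
apply: contra wn0 => /eqP cw.
have := ms_uniq Pe; rewrite dotDr dotZr cw mulr0 addr0 => /(_ erefl)/eqP.
by rewrite -subr_eq0 addrC addKr scaler_eq0 gt_eqF.
Qed.

(** Spans an extreme ray of the tangent cone: the constraints that are tight at
    [u] leave only the line through [u]. *)
Definition extreme u := [/\ tangent u, u != 0 & forall w, w \in U ->
  (forall x, ms x = 0 -> u x = 0 -> w x = 0) -> exists k : R, w = k *: u].

(** The constraints of the tangent cone that are not tight at [u]. *)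
Definition slack u := [pred x | (ms x == 0) && (u x != 0)].

(** Move from [u] in the direction [w] until the first constraint becomes tight;
    the constraints that are tight at [u] remain so. *)
Lemma tangent_hit u w : tangent u -> w \in U ->
  (forall x, ms x = 0 -> u x = 0 -> w x = 0) ->
  ~ tangent w -> exists2 k : R, 0 < k & tangent (u + k *: w) /\
    (#|slack (u + k *: w)%R| < #|slack u|)%N.
Proof.
move=> Tu wU uw Tw.
have [x0 /andP[mx0 wx0]] : exists x, (ms x == 0) && ((w x : R) < 0).
  apply: contrapT => nx; apply: Tw; split=> // x mx.
  by rewrite leNgt; apply/negP => wx; apply: nx; exists x; rewrite mx eqxx.
have := @exists_argmin R X [pred x | (ms x == 0) && ((w x : R) < 0)]
  (fun x => (u x : R) / - w x) x0.
rewrite /= mx0 wx0 => /(_ isT)[y /andP[/eqP my wy] ymin].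
have uy : 0 < u y.
  rewrite lt_neqAle Tu.2// andbT eq_sym; apply/eqP => /(uw _ my) wy0.
  by move: wy; rewrite wy0 ltxx.
have k0 : 0 < (u y : R) / - w y by rewrite divr_gt0// oppr_gt0.
exists ((u y : R) / - w y) => //; set k := (_ / _) in k0 ymin *.
have vE x : (u + k *: w) x = (u x : R) + k * w x by rewrite !ffunE.
split.
  split=> [|x mx]; first by rewrite memvD ?memvZ//; case: Tu.
  rewrite vE; have [wx|wx] := leP 0 (w x : R).
    by rewrite addr_ge0// ?Tu.2// mulr_ge0// ltW.
  have := ymin x; rewrite mx eqxx wx => /(_ isT).
  by rewrite ler_pdivlMr ?oppr_gt0// mulrN; lra.
apply: proper_card; apply/properP; split.
  apply/fintype.subsetP => x; rewrite !inE => /andP[/eqP mx]; rewrite mx eqxx/=.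
  apply: contraNN => /eqP ux.
  by apply/eqP; apply: (etrans (vE x)); rewrite ux uw// mulr0 addr0.
exists y; first by rewrite !inE my eqxx/= gt_eqF.
rewrite !inE my eqxx/= negbK.
by apply/eqP; apply: (etrans (vE y)); rewrite /k invrN mulrN mulNr divfK ?subrr ?lt_eqF.
Qed.

(** The tangent cone is generated by its extreme rays.  If [u] is not extreme, some
    [v] independent of [u] keeps the tight constraints tight, and can be chosen
    with [dot c v = 0].  Then neither [v] nor [- v] is tangent, so that moving
    from [u] in both directions makes a further constraint tight, and [u] is a
    sum of multiples of the two points that are reached. *)
Lemma tangent_ind (Q : vec R X -> Prop) :
  (forall u, extreme u -> Q u) ->
  (forall u v, Q u -> Q v -> Q (u + v)) ->
  forall w, tangent w -> w != 0 -> Q w.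
Proof.
move=> Qext QD w; have [n] := ubnP #|slack w|; elim: n w => // n IH u lt_n Tu u0.
have [/Qext//|next] := pselect (extreme u).
have [w [wU uw wk]] : exists w, [/\ w \in U,
    (forall x, ms x = 0 -> u x = 0 -> w x = 0) & forall k : R, w <> k *: u].
  apply: contrapT => nw; apply: next; split=> // w wU uw.
  apply: contrapT => wk; apply: nw; exists w; split=> // k wE.
  by apply: wk; exists k.
have cu := tangent_dot_lt0 Tu u0.
pose v := w - (dot c w / dot c u) *: u.
have cv : dot c v = 0 by rewrite dotBr dotZr divfK ?subrr ?lt_eqF.
have v0 : v != 0 by rewrite subr_eq0; apply/eqP; exact: wk.
have vU : v \in U by rewrite memvB ?memvZ//; case: Tu.
have uv x : ms x = 0 -> u x = 0 -> v x = 0.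
  by move=> mx ux; rewrite !ffunE uw// ux scaler0 subr0.
have NT z : dot c z = 0 -> z != 0 -> ~ tangent z.
  by move=> cz z0 /tangent_dot_lt0 /(_ z0); rewrite cz ltxx.
have [al al0 [Tal cal]] := tangent_hit Tu vU uv (NT _ cv v0).
have [|||be be0 [Tbe cbe]] := @tangent_hit u (- v) Tu.
- by rewrite rpredN.
- by move=> x mx ux; rewrite ffunE uv// oppr0.
- by apply: NT; rewrite ?dotNr ?cv ?oppr0// oppr_eq0.
have slackZ (k : R) z : k != 0 -> #|slack (k *: z)| = #|slack z|.
  move=> k0; apply: eq_card => x; rewrite !inE ffunE.
  by rewrite -[_ *: _]/(k * _) mulf_eq0 (negPf k0).
have part (k : R) z : 0 < k -> dot c z = 0 -> tangent (u + z) ->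
    (#|slack (u + z)%R| < #|slack u|)%N -> Q (k *: (u + z)).
  move=> k0 cz Tz sz; apply: IH; rewrite ?slackZ ?gt_eqF//.
  - by rewrite -ltnS; exact: leq_trans lt_n.
  - by apply: tangentZ => //; exact: ltW.
  - rewrite scaler_eq0 gt_eqF//=; apply/eqP => uz0; move: cu.
    have : dot c (u + z) = 0 by rewrite uz0 dot0r.
    by rewrite dotDr cz addr0 => ->; rewrite ltxx.
have ab0 : 0 < al + be by rewrite addr_gt0.
have -> : u = (be / (al + be)) *: (u + al *: v) +
              (al / (al + be)) *: (u + be *: - v).
  have combo (p q : R) : p = be / (al + be) * (p + al * q) +
      al / (al + be) * (p + be * - q) by field; rewrite gt_eqF.
  by apply/ffunP => x; rewrite !ffunE; exact: combo.
apply: QD => //; apply: part => //.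
- by rewrite divr_gt0.
- by rewrite dotZr cv mulr0.
- by rewrite divr_gt0.
- by rewrite dotZr dotNr cv oppr0 mulr0.
Qed.

Hypothesis P_sum1 : forall mu, P mu -> \sum_x (mu x : R) = 1.

Lemma cardX_gt0 : (0 < #|X|)%N.
Proof.
rewrite lt0n; apply/eqP => X0; have := P_sum1 msP.
rewrite big1 => [/esym/eqP|x _]; first by rewrite oner_eq0.
by have := fintype0 x X0.
Qed.

(** The functionals maximal at both [mu] and [nu] include everything orthogonal to
    [U], and [- unitv x] for each [x] outside of both supports.  So what is
    orthogonal to all of them is a direction of [P] inside the union of the supports.
    This computes the dimension in the definition of neighbors. *)
Lemma normals_orth W mu nu b : P mu -> P nu ->
  (forall a a', argmax P (dot a) mu /\ argmax P (dot a) nu ->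
    argmax P (dot a') mu /\ argmax P (dot a') nu -> a - a' \in W) ->
  (forall a, a \in W -> dot b a = 0) ->
  b \in U /\ forall x, mu x = 0 -> nu x = 0 -> b x = 0.
Proof.
move=> Pmu Pnu AW bW.
have A0 : argmax P (dot 0) mu /\ argmax P (dot 0) nu.
  by split; split=> // la _; rewrite !dot0l.
have bA a : argmax P (dot a) mu -> argmax P (dot a) nu -> dot b a = 0.
  by move=> amu anu; apply: bW; rewrite -[a]subr0; apply: AW.
split=> [|x mx nx].
  apply: contrapT => /negP /separation[a aU]; apply; rewrite dotC.
  have aP la la' : P la -> P la' -> dot a la' <= dot a la.
    by move=> Pla Pla'; rewrite -subr_le0 -dotBr aU// P_subU.
  by apply: bA; split=> // la Pla; apply: aP.
rewrite -dot_unitv dotC -[LHS]opprK -dotNr bA ?oppr0//; split=> // la Pla.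
all: rewrite !dotNl !dot_unitv.
  by rewrite mx oppr0 oppr_le0 P_ge0.
by rewrite nx oppr0 oppr_le0 P_ge0.
Qed.

(** For [nu = ms] the functionals would span the whole space, since by
    [normals_orth] a vector orthogonal to them is tangent along with its
    opposite. *)
Lemma neighbor_neq nu : neighbors P ms nu -> nu <> ms.
Proof.
move=> [_ _ [_ [V [AV _ dimV]]]] E; rewrite E in AV.
have [v vV] : exists v, v \notin V.
  apply: contrapT => nv; have : V = fullv.
    apply/eqP; rewrite eqEsubv subvf/=; apply/subvP => v _.
    by apply: contrapT => /negP vV; apply: nv; exists v.
  move=> VE; move: dimV; rewrite VE dimv_full => /eqP.
  by case: #|X| cardX_gt0 => // n _ /=; rewrite gtn_eqF.
have [b bV bv] := separation vV.
have [bU b0] := normals_orth msP msP AV bV.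
have bn : b != 0 by apply/eqP => b00; apply: bv; rewrite b00 dotC dot0r.
have Tb : tangent b by split=> // x mx; rewrite b0.
have TNb : tangent (- b).
  by split=> [|x mx]; rewrite ?rpredN// ffunE b0// oppr0.
have := tangent_dot_lt0 Tb bn.
by have := tangent_dot_lt0 TNb; rewrite oppr_eq0 dotNr => /(_ bn); lra.
Qed.

Lemma vertex_ms : vertex P ms.
Proof.
exists c; apply/seteqP; split=> [nu [Pnu nu_max]|_ ->]; last first.
  by split=> [|nu Pnu]; [exact: msP|exact: ms_max].
by apply: ms_uniq => //; apply/le_anti/andP; split; [exact: ms_max|exact: nu_max].
Qed.

Lemma exists_neg_coord u : u \in U -> u != 0 -> exists x, (u x : R) < 0.
Proof.
move=> uU u0; apply: contrapT => nx; move/eqP: u0; apply; apply/ffunP => x.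
have u_ge0 y : 0 <= (u y : R).
  by rewrite leNgt; apply/negP => uy; apply: nx; exists y.
have /eqP := U_sum0 uU; rewrite psumr_eq0 => [|y _]; last exact: u_ge0.
by move=> /allP /(_ x (mem_index_enum x)) /= /eqP ->; rewrite ffunE.
Qed.

(** Follow the ray as long as it stays in [P].  At the end some [y] with [u y < 0]
    reaches 0.  The end point [nu] is a vertex because a point of [P] that
    vanishes where [nu] does lies on the ray and vanishes at [y]; and by
    [normals_orth] the functionals maximal at both ends span the hyperplane
    orthogonal to [u]. *)
Lemma extreme_neighbor u : extreme u ->
  exists2 k : R, 0 < k & neighbors P ms (ms + k *: u).
Proof.
move=> [[uU u_ge0] un0 uext].
have [x0 ux0] := exists_neg_coord uU un0.
have [y /= uy ymin] := @exists_argmin R X [pred x | (u x : R) < 0]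
  (fun x => (ms x : R) / - u x) x0 ux0.
have msy : 0 < (ms y : R).
  rewrite lt_neqAle P_ge0// andbT eq_sym; apply/eqP => /u_ge0.
  by rewrite leNgt uy.
have k0 : 0 < (ms y : R) / - u y by rewrite divr_gt0// oppr_gt0.
set k := (_ / _) in k0 ymin; exists k => //; set nu := ms + k *: u.
have nuE x : nu x = (ms x : R) + k * u x by rewrite !ffunE.
have Pnu : P nu.
  apply: P_move => // [|x]; first exact: memvZ.
  rewrite -[(k *: u) x]/((k *: u) x : R) ffunE -[_ *: _]/(k * (u x : R)).
  have [ux|ux] := leP 0 (u x : R).
    by apply: addr_ge0; [exact: P_ge0|rewrite mulr_ge0// ltW].
  have := ymin x ux; rewrite ler_pdivlMr ?oppr_gt0// mulrN; lra.
have nuy : nu y = 0.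
  by apply: (etrans (nuE y)); rewrite /k invrN mulrN mulNr divfK ?subrr ?lt_eqF.
have nu0 x : ms x = 0 -> u x = 0 -> nu x = 0.
  by move=> mx ux; apply: (etrans (nuE x)); rewrite mx ux mulr0 addr0.
split; first exact: vertex_ms.
  (* minus the mass outside of the support of nu; it vanishes exactly on the
     points of P supported there *)
  pose a : vec R X := - \sum_(x | nu x == 0) unitv R x.
  have aE la : dot a la = - \sum_(x | nu x == 0) (la x : R).
    rewrite dotNl; have := linear_sum (dot_form la) (index_enum X)
      (fun x => nu x == 0) (@unitv R X); rewrite /= {1}/dot_form dotC => ->.
    congr (- _); apply: eq_bigr => x _.
    by rewrite /dot_form dotC dot_unitv.
  have anu : dot a nu = 0.
    by rewrite aE big1 ?oppr0// => x /eqP.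
  exists a; apply/seteqP; split=> [la [Pla la_max]|_ ->]; last first.
    split=> // la Pla; rewrite anu aE oppr_le0 sumr_ge0// => x _.
    exact: P_ge0.
  have la0 x : nu x = 0 -> la x = 0.
    move=> nx; have := la_max _ Pnu; rewrite anu aE oppr_ge0 => sle.
    have : \sum_(x | nu x == 0) (la x : R) == 0.
      by rewrite eq_le sle/= sumr_ge0// => z _; exact: P_ge0.
    rewrite psumr_eq0 => [|z _]; last exact: P_ge0.
    by move=> /allP /(_ x (mem_index_enum x)); rewrite /= nx eqxx => /eqP.
  have [|x mx ux|kk lank] := uext (la - nu); first exact: P_subU.
    by rewrite vecBE la0 nu0// subrr.
  have : (la - nu) y = 0 by rewrite vecBE la0 nuy// subrr.
  rewrite lank ffunE => /eqP; rewrite scaler_eq0 (lt_eqF uy) orbF => /eqP kk0.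
  by apply/eqP; rewrite -subr_eq0 lank kk0 scale0r.
split.
  by exists 0; split; split=> // la _; rewrite !dot0l.
exists (orth u); split.
- move=> a a' [[_ am] [_ an]] [[_ am'] [_ an']].
  have flat b : (forall la, P la -> dot b la <= dot b ms) ->
      (forall la, P la -> dot b la <= dot b nu) -> dot b u = 0.
    move=> bm bn; have := bm _ Pnu; have := bn _ msP.
    rewrite dotDr dotZr => h1 h2; apply/eqP.
    have : k * dot b u == 0 by rewrite eq_le; apply/andP; split; lra.
    by rewrite mulf_eq0 gt_eqF.
  by rewrite mem_orth dotBr dotC flat// dotC flat// subrr.
- move=> W AW; apply/subvP => a; rewrite mem_orth => /eqP ua.
  apply: contrapT => /negP /separation[b bW]; apply.
  have [bU b0] := normals_orth msP Pnu AW bW.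
  have [|kk ->] := uext b bU; last by rewrite dotC dotZr dotC ua mulr0.
  by move=> x mx ux; apply: b0 => //; exact: nu0.
- exact: dim_orth.
Qed.

Lemma neighbor_exists mu : P mu -> mu <> ms -> neighbors P ms !=set0.
Proof.
move=> Pmu mums; apply: (@tangent_ind (fun=> neighbors P ms !=set0)) => //.
- by move=> u /extreme_neighbor[k _ nk]; exists (ms + k *: u).
- exact: tangent_sub Pmu.
- by rewrite subr_eq0; apply/eqP.
Qed.

Lemma neighbor_P nu : neighbors P ms nu -> P nu.
Proof.
by move=> [_ [a Ha] _]; have [] : argmax P (dot a) nu by rewrite Ha.
Qed.

Lemma neighbor_ratio_gt0 nu : neighbors P ms nu ->
  0 < (dot c ms - dot c nu) / tv_norm (ms - nu).
Proof.
move=> nb; have Pnu := neighbor_P nb; have nm := neighbor_neq nb.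
rewrite divr_gt0//; last first.
  by apply: tv_norm_gt0; rewrite subr_eq0; apply/eqP => /esym.
rewrite subr_gt0 lt_neqAle ms_max// andbT; apply/eqP => /ms_uniq.
by move=> /(_ Pnu).
Qed.

Lemma edge_gap_le nu : neighbors P ms nu ->
  edge_gap c P ms <= (dot c ms - dot c nu) / tv_norm (ms - nu).
Proof.
move=> nb; apply: ge_inf; last by exists nu.
by exists 0 => _ [la nla <-]; exact/ltW/neighbor_ratio_gt0.
Qed.

(** The infimum runs over finitely many positive ratios, as vertices are
    determined by their supports ([vertex_support]). *)
Lemma edge_gap_gt0 : neighbors P ms !=set0 -> 0 < edge_gap c P ms.
Proof.
move=> [nu0 nb0].
pose supp mu : {set X} := finset (fun x => mu x != 0).
pose rep (S : {set X}) := xget 0 [set nu | neighbors P ms nu /\ supp nu = S].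
have repE nu : neighbors P ms nu -> rep (supp nu) = nu.
  move=> nb; rewrite /rep; case: xgetP => [mu _ [nbmu smu]|/(_ nu)[]//].
  have [_ vmu _] := nbmu; have [_ vnu _] := nb.
  apply: (vertex_support vnu (neighbor_P nbmu)) => x nx.
  by move/setP: smu => /(_ x); rewrite !inE nx eqxx => /negbFE/eqP.
pose f S := (dot c ms - dot c (rep S)) / tv_norm (ms - rep S).
have [|e e0 fe] := @exists_pos_lower_bound R _ (fun S => `[< neighbors P ms (rep S) >]) f.
  by move=> S /asboolP; exact: neighbor_ratio_gt0.
apply: (lt_le_trans e0); apply: lb_le_inf.
  by exists ((dot c ms - dot c nu0) / tv_norm (ms - nu0)), nu0.
move=> _ [nu nb <-]; rewrite -(repE _ nb); apply: fe; apply/asboolP.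
by rewrite repE.
Qed.

(** On the tangent cone the inequality is additive in the direction, because the
    gap is linear and the norm subadditive; so it only needs to be checked on
    extreme rays, where it is the definition of [edge_gap]. *)
Lemma gap_ge_tv mu : P mu ->
  edge_gap c P ms * tv_norm (ms - mu) <= dot c ms - dot c mu.
Proof.
move=> Pmu; have [->|mum] := eqVneq mu ms.
  by rewrite !subrr tv_normE big1 ?mulr0// => x _; rewrite ffunE normr0.
suff : edge_gap c P ms * tv_norm (mu - ms) <= - dot c (mu - ms).
  by rewrite -tv_normN opprB dotBr opprB.
pose Q w := edge_gap c P ms * tv_norm w <= - dot c w.
apply: (@tangent_ind Q) => [u eu|u v Qu Qv||]; last 2 first.
- exact: tangent_sub.
- by rewrite subr_eq0.
- have [k k0 nb] := extreme_neighbor eu.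
  have [_ u0 _] := eu; have tu0 := tv_norm_gt0 u0.
  have := edge_gap_le nb; rewrite -tv_normN opprB [_ - ms]addrC addKr dotDr dotZr.
  rewrite (tv_normZ _ (ltW k0)) ler_pdivlMr ?(mulr_gt0 k0 tu0)// => h.
  have : k * (edge_gap c P ms * tv_norm u) <= k * - dot c u by lra.
  by rewrite ler_pM2l.
- have := tv_normD u v; move: Qu Qv; rewrite /Q dotDr => Qu Qv tuv.
  have eg0 : 0 <= edge_gap c P ms.
    by apply: ltW; apply: edge_gap_gt0; apply: (neighbor_exists Pmu); apply/eqP.
  have : edge_gap c P ms * tv_norm (u + v) <=
         edge_gap c P ms * (tv_norm u + tv_norm v) by rewrite ler_wpM2l.
  by rewrite mulrDr; lra.
Qed.

End Polytope.

(** * Continuity of x ln x and existence of maximizers *)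

Section Compactness.
Variables (R : realType) (X : finType).

(** A majorant that tends to 0 with [y]; for small [y] it comes from
    [y ln y = 2 sqrt y * (sqrt y * ln (sqrt y))]. *)
Lemma xlnx_bound (y : R) : `|y * ln y| <= `|y| * `|y| + 2 * Num.sqrt `|y|.
Proof.
have [y0|y0] := leP y 0.
  by rewrite ln0// mulr0 normr0 addr_ge0 ?mulr_ge0 ?sqrtr_ge0.
rewrite (gtr0_norm y0); have sy : 0 < Num.sqrt y by rewrite sqrtr_gt0.
have ey : y = Num.sqrt y * Num.sqrt y by rewrite -expr2 sqr_sqrtr// ltW.
have lup := ln_le_sub1 y0.
have llo : - (y * ln y) <= 2 * Num.sqrt y.
  rewrite {1 2}ey lnM ?posrE//.
  have := relent_ge (ltW sy) (@ltr01 R); rewrite divr1.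
  move: (ln _) => l h; nra.
rewrite ler_norml; apply/andP; split; first by nra.
by have := sqrtr_ge0 y; nra.
Qed.

Lemma norm_xlnx_cvg0 : `|z * ln z| @[z --> nbhs (0 : R)] --> (0 : R).
Proof.
apply: (@squeeze_cvgr _ _ _ _ (fun=> 0)
  (fun z : R => `|z| * `|z| + 2 * Num.sqrt `|z|)).
- by near=> z; rewrite normr_ge0 xlnx_bound.
- exact: cvg_cst.
have n0 : `|z| @[z --> nbhs (0 : R)] --> (0 : R).
  by have := @norm_continuous R R 0; rewrite /continuous_at normr0.
rewrite [X in _ --> X](_ : _ = 0 * 0 + 2 * Num.sqrt 0); last first.
  by rewrite sqrtr0; ring.
apply: cvgD; first exact: cvgM.
apply: cvgM; first exact: cvg_cst.
by apply: (cvg_comp _ _ n0); exact: sqrt_continuous.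
Unshelve. all: by end_near. Qed.

Lemma continuous_xlnx : continuous (fun y : R => y * ln y).
Proof.
move=> y; have [y0|y0|->] := ltgtP y 0.
- apply: (@near_cst_continuous _ _ (0 : R)); near=> z.
  by rewrite ln0 ?mulr0//; apply: ltW; near: z; exact: lt_nbhsl.
- by apply: cvgM; [exact: cvg_id|exact: continuous_ln].
by rewrite /continuous_at mul0r; apply/norm_cvg0P; exact: norm_xlnx_cvg0.
Unshelve. all: by end_near. Qed.

Import ArrowAsProduct.

Lemma continuous_sum_coord (g : X -> R -> R) :
  (forall x, continuous (g x)) ->
  continuous (fun f : X -> R => \sum_x g x (f x)).
Proof.
move=> gc; apply: continuous_big => [|x _]; first exact: add_continuous.
move=> f; apply: cvg_comp; last exact: gc.
exact: (@proj_continuous X (fun=> R) x).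
Qed.

(** In the product topology on functions, [P] is a subset of the cube [0, 1]^X and
    is cut out by closed conditions: nonnegativity, and by [separation] one
    linear equation for each [b] orthogonal to [U]. *)
Lemma compact_max (P : set (vec R X)) (U : {vspace vec R X}) (p : vec R X)
  (g : X -> R -> R) :
  (forall mu, P mu <-> (forall x, 0 <= mu x) /\ mu - p \in U) ->
  (forall mu x, P mu -> (mu x : R) <= 1) -> P p ->
  (forall x, continuous (g x)) ->
  exists2 mu, P mu & forall nu, P nu ->
    \sum_x g x (nu x) <= \sum_x g x (mu x).
Proof.
move=> PE P1 Pp gc.
pose A : set (X -> R) := [set f | P [ffun x => f x : R^o]].
have AE : A = [set f | forall x, 0 <= f x] `&`
    \bigcap_(b in [set b : vec R X | forall u, u \in U -> dot b u = 0])
      [set f | \sum_x (b x : R) * f x = dot b p].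
  apply/seteqP; split=> f.
    move=> /PE [f0 fU]; split=> [x|b /= bU]; first by have := f0 x; rewrite ffunE.
    have := bU _ fU; rewrite dotBr => /eqP; rewrite subr_eq0 => /eqP <-.
    by apply: eq_bigr => x _; rewrite ffunE.
  move=> [f0 fb]; apply/PE; split=> [x|]; first by rewrite ffunE.
  apply: contrapT => /negP /separation[b bU]; apply; rewrite dotBr -(fb b bU).
  apply/eqP; rewrite subr_eq0; apply/eqP; apply: eq_bigr => x _.
  by rewrite ffunE.
have cA : compact A.
  apply: (@subclosed_compact _ _ [set f : X -> R | forall x, f x \in `[0, 1] ]).
  - rewrite AE; apply: closedI.
      have -> : [set f : X -> R | forall x, 0 <= f x] =
          \bigcap_(x in [set: X]) (@proj X (fun=> R) x @^-1` [set y | 0 <= y]).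
        by apply/seteqP; split=> f; [move=> f0 x _; exact: f0|move=> f0 x; exact: f0].
      apply: closed_bigI => x _; apply: (continuous_closedP _).1; last exact: closed_ge.
      exact: proj_continuous.
    apply: closed_bigI => b _.
    have := (continuous_closedP (fun f : X -> R => \sum_x (b x : R) * f x)).1.
    move=> /(_ _ _ (closed_eq (y := dot b p))); apply.
    apply: (@continuous_sum_coord (fun x y => (b x : R) * y)) => x y.
    by apply: cvgM; [exact: cvg_cst|exact: cvg_id].
  - apply: (@tychonoff X (fun=> R) (fun=> [set` `[0, 1]])) => x.
    exact: segment_compact.
  - move=> f Af x; rewrite /= in_itv/=; have := P1 _ x Af; rewrite ffunE => ->.
    by move/PE : Af => [/(_ x)]; rewrite ffunE andbT.
have [||f fA fmax] := @compact_EVT_max _ R (fun f : X -> R => \sum_x g x (f x)) A _ cA.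
- exists (fun x => p x : R); rewrite /A /=; suff -> : [ffun x => p x] = p by [].
  by apply/ffunP => x; rewrite ffunE.
- by apply: continuous_subspaceT; exact: continuous_sum_coord.
exists [ffun x => f x : R^o]; first by rewrite inE in fA.
move=> nu Pnu; rewrite [leRHS](_ : _ = \sum_x g x (f x)).
  apply: (fmax (fun x => nu x : R)); rewrite inE /A /=.
  suff -> : [ffun x => nu x] = nu by [].
  by apply/ffunP => x; rewrite ffunE.
by apply: eq_bigr => x _; rewrite ffunE.
Qed.

End Compactness.

(** * Optimality conditions for the regularized problem *)

Section Regularized.
Variables (R : realType) (X : finType).
Variables (c : vec R X) (P : set (vec R X)) (U : {vspace vec R X}).
Implicit Types (u v w mu nu : vec R X) (t s : R) (x : X).

Hypothesis PE : forall mu nu, P mu ->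
  P nu <-> (forall x, 0 <= nu x) /\ nu - mu \in U.
Hypothesis U_sum0 : forall u, u \in U -> \sum_x (u x : R) = 0.
Hypothesis P_sum1 : forall mu, P mu -> \sum_x (mu x : R) = 1.
Hypothesis P_pos : exists p, P p /\ forall x, 0 < p x.

Lemma P_simplex mu : P mu -> simplex mu.
Proof. by move=> Pmu; split=> [x|]; [exact: (P_ge0 PE _ Pmu)|exact: P_sum1]. Qed.

Lemma P_sum_eq mu nu : P mu -> P nu -> \sum_x (mu x : R) = \sum_x (nu x : R).
Proof. by move=> /P_sum1 -> /P_sum1 ->. Qed.

Lemma P_convex (q : R) mu nu : 0 <= q <= 1 -> P mu -> P nu ->
  P (q *: mu + (1 - q) *: nu).
Proof.
move=> /andP[q0 q1] Pmu Pnu; apply/(PE _ Pmu); split=> [x|].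
  rewrite !ffunE; apply: addr_ge0; apply: mulr_ge0 => //.
  - exact: (P_ge0 PE _ Pmu).
  - by rewrite subr_ge0.
  - exact: (P_ge0 PE _ Pnu).
have -> : q *: mu + (1 - q) *: nu - mu = (1 - q) *: (nu - mu).
  have combo (a b : R) : q * a + (1 - q) * b - a = (1 - q) * (b - a) by ring.
  by apply/ffunP => x; rewrite !ffunE; exact: combo.
by apply: memvZ; exact: (P_subU PE Pmu Pnu).
Qed.

(** Scaled by [t], so that [t = 0] is the maximization of the entropy itself. *)
Definition reg_objective t mu : R := t * dot c mu + entropy mu.

Lemma reg_argmax_neq0 t : argmax P (reg_objective t) !=set0.
Proof.
have [p [Pp _]] := P_pos.
pose g x (y : R) := t * (c x : R) * y - y * ln y.
have objE mu : reg_objective t mu = \sum_x g x (mu x).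
  rewrite /reg_objective /dot /entropy mulr_sumr -sumrB; apply: eq_bigr => x _.
  by rewrite /g mulrA.
have [||x|mu Pmu mumax] := @compact_max R X P U p g _ _ Pp.
- by move=> mu; exact: PE.
- by move=> mu x /P_simplex; exact: simplex_le1.
- move=> y; apply: cvgB; last exact: continuous_xlnx.
  by apply: cvgM; [exact: cvg_cst|exact: cvg_id].
by exists mu; split=> // nu Pnu; rewrite !objE; exact: mumax.
Qed.

(** At a vanishing coordinate the entropy has infinite slope: towards a positive
    [p] the gain is of order [- s ln s], against a change of order [s] in all
    other terms. *)
Lemma reg_argmax_gt0 t mu : argmax P (reg_objective t) mu -> forall x, 0 < (mu x : R).
Proof.
move=> [Pmu mumax] x; have [p [Pp p0]] := P_pos.
rewrite lt_neqAle (P_ge0 PE x Pmu) andbT; apply/eqP => /esym mux.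
pose D := reg_objective t p - reg_objective t mu.
have key (s : R) : 0 < s <= 1 -> D - (p x : R) * ln s <= 0.
  move=> /[dup] s01 /andP[s0 s1].
  have Ppi : P (s *: p + (1 - s) *: mu) by apply: P_convex => //; rewrite ltW.
  have := entropy_mix (fun z => ltW (p0 z)) (fun z => P_ge0 PE z Pmu) s01 mux.
  have := mumax _ Ppi; rewrite /reg_objective dotDr !dotZr => h1 h2.
  rewrite -(pmulr_rle0 _ s0) /D /reg_objective; lra.
pose M := (`|D| + 1) / (p x : R).
have M0 : 0 <= M by rewrite divr_ge0 ?ltW// addr_ge0.
have := key (expR (- M)); rewrite expR_gt0 expRK.
have -> : expR (- M) <= 1 by rewrite -expR0 ler_expR oppr_le0.
move=> /(_ isT); rewrite mulrN opprK /M mulrC divfK ?gt_eqF//.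
by have := ler_norm (- D); rewrite normrN; lra.
Qed.

(** The first order condition: up to constants, the gradient of the objective is
    [t * c - ln mu]. *)
Definition reg_opt t mu := [/\ P mu, (forall x, 0 < (mu x : R)) &
  forall w, w \in U -> t * dot c w = \sum_x (w x : R) * ln (mu x)].

(** Along [mu + e * w] the objective changes by [e * (t * dot c w - L)] up to a
    term of order [e ^+ 2], which [kl_le_chi2] bounds. *)
Lemma reg_argmax_opt t mu : argmax P (reg_objective t) mu -> reg_opt t mu.
Proof.
move=> Hmu; have mu0 := reg_argmax_gt0 Hmu; have [Pmu mumax] := Hmu.
split=> //.
have half w : w \in U -> t * dot c w <= \sum_x (w x : R) * ln (mu x).
  move=> wU; set L := \sum_x _.
  pose B := \sum_x (w x : R) ^+ 2 / mu x.
  have B0 : 0 <= B.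
    by apply: sumr_ge0 => x _; rewrite divr_ge0 ?sqr_ge0// ltW.
  have [||e e0 Pe] := @P_step R X P U PE mu w Pmu => //.
    by move=> x mux; have := mu0 x; rewrite mux ltxx.
  have key (q : R) : 0 < q <= 1 -> t * dot c w - L <= q * e * B.
    move=> /andP[q0 q1].
    have := @P_convex q _ _ _ Pe Pmu; rewrite q1 ltW// => /(_ isT).
    have -> : q *: (mu + e *: w) + (1 - q) *: mu = mu + (q * e) *: w.
      have combo (a b : R) : q * (a + e * b) + (1 - q) * a = a + q * e * b.
        by ring.
      by apply/ffunP => x; rewrite !ffunE; exact: combo.
    have : 0 < q * e by rewrite mulr_gt0.
    move: (q * e) => {e e0 Pe q q0 q1} e e0 Pe.
    have Hs := entropy_sub (fun x => P_ge0 PE x Pe) mu0.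
    have Hk := kl_le_chi2 (fun x => P_ge0 PE x Pe) mu0 (P_sum_eq Pe Pmu).
    have dE x : ((mu + e *: w) x : R) - mu x = e * w x.
      by rewrite !ffunE addrC addKr.
    have E1 : \sum_x (((mu + e *: w) x : R) - mu x) * ln (mu x) = e * L.
      by rewrite mulr_sumr; apply: eq_bigr => x _; rewrite dE mulrA.
    have E2 : \sum_x (((mu + e *: w) x : R) - mu x) ^+ 2 / mu x = e * (e * B).
      by rewrite !mulr_sumr; apply: eq_bigr => x _; rewrite dE exprMn !mulrA.
    have := mumax _ Pe; rewrite /reg_objective dotDr dotZr => Hm.
    rewrite E1 in Hs; rewrite E2 in Hk.
    by rewrite -(ler_pM2l e0); lra.
  rewrite leNgt -subr_gt0; apply/negP => D0.
  move: (t * _ - L) D0 key => D D0 key.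
  have r0 : 0 <= e * B / D.
    by apply: divr_ge0; [apply: mulr_ge0 => //; exact: ltW|exact: ltW].
  have s0 : 0 < 1 + e * B / D by rewrite ltr_pwDl.
  pose q := (1 + e * B / D)^-1 / 2.
  have q0 : 0 < q by rewrite divr_gt0// invr_gt0.
  have i1 : (1 + e * B / D)^-1 <= 1.
    by rewrite invf_le1// lerDl.
  have := key q; rewrite q0 (_ : q <= 1); last by rewrite /q; lra.
  move=> /(_ isT) h.
  have q1 : q * (1 + e * B / D) = 1 / 2 by rewrite /q mulrAC mulVf// gt_eqF.
  have q2 : q * e * B = D * (q * (e * B / D)) by field; rewrite gt_eqF.
  have q3 : D * (q * (e * B / D)) = D * (1 / 2 - q) by rewrite -q1; ring.
  have : 0 < D * (1 / 2 + q) by rewrite mulr_gt0// addr_gt0.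
  lra.
move=> w wU; apply/le_anti; rewrite half//=.
have := half (- w); rewrite rpredN => /(_ wU); rewrite dotNr.
rewrite (eq_bigr (fun x => - ((w x : R) * ln (mu x)))) => [|x _].
  by rewrite sumrN mulrN lerN2.
by rewrite ffunE mulNr.
Qed.

Lemma argmax_ext (f g : vec R X -> R) :
  (forall mu nu, P mu -> P nu -> (f mu <= f nu) = (g mu <= g nu)) ->
  argmax P f = argmax P g.
Proof.
move=> fg; apply/seteqP; split=> mu [Pmu mumax]; split=> // nu Pnu.
  by rewrite -fg// mumax.
by rewrite fg// mumax.
Qed.

Lemma reg_sol_opt t : 0 < t -> reg_opt t (reg_sol c P t).
Proof.
move=> t0; apply: reg_argmax_opt; rewrite /reg_sol (@argmax_ext _ (reg_objective t)).
  by have [mu Hmu] := reg_argmax_neq0 t; exact: xgetI Hmu.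
move=> mu nu _ _; rewrite -(ler_pM2l t0) !mulrDr !mulrA divff ?gt_eqF//.
by rewrite !mul1r.
Qed.

Lemma max_entropy_opt : reg_opt 0 (max_entropy_sol P).
Proof.
apply: reg_argmax_opt; rewrite /max_entropy_sol (@argmax_ext _ (reg_objective 0)).
  by have [mu Hmu] := reg_argmax_neq0 0; exact: xgetI Hmu.
by move=> mu nu _ _; rewrite /reg_objective !mul0r !add0r.
Qed.

(** The divergence to the optimum is the loss in the objective: the linear terms
    of [entropy_sub] cancel by the first order condition. *)
Lemma opt_kl t mu nu : reg_opt t mu -> P nu -> kl nu mu = reg_objective t mu - reg_objective t nu.
Proof.
move=> [Pmu mu0 fo] Pnu.
have := entropy_sub (fun x => P_ge0 PE x Pnu) mu0.
have := fo _ (P_subU PE Pmu Pnu); rewrite dotBr.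
rewrite (eq_bigr (fun x => ((nu x : R) - mu x) * ln (mu x))) => [h1 h2|x _].
  by rewrite /reg_objective; lra.
by rewrite vecBE.
Qed.

Lemma opt_max t mu nu : reg_opt t mu -> P nu -> reg_objective t nu <= reg_objective t mu.
Proof.
move=> /[dup] o [Pmu mu0 _] Pnu; rewrite -subr_ge0 -(opt_kl o Pnu).
exact: kl_ge0 (fun x => P_ge0 PE x Pnu) mu0 (P_sum_eq Pnu Pmu).
Qed.

End Regularized.

(** * Differential inequalities without derivatives *)

Section ContinuousInduction.
Variable R : realType.

(** Let [sup S] be the end of the maximal interval where [f <= B].  The inequality
    passes to [sup S] from the left since [f] decreases and [B] is continuous, and
    beyond it by the last hypothesis. *)
Lemma continuous_induction (f B : R -> R) (a : R) : f a <= B a ->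
  (forall s t, a <= s -> s <= t -> f t <= f s) ->
  (forall t, a <= t -> {for t, continuous B}) ->
  (forall t, a <= t -> f t <= B t ->
    exists2 d, 0 < d & forall s, t < s -> s < t + d -> f s <= B s) ->
  forall t, a <= t -> f t <= B t.
Proof.
move=> fa fmono Bcont step t1 at1; apply: contrapT => /negP; rewrite -ltNge => Bf.
pose S := [set s | [/\ a <= s, s <= t1 & forall u, a <= u -> u <= s -> f u <= B u]].
have Sa : S a.
  by split=> // u au ua; have -> : u = a by apply/le_anti; rewrite au ua.
have ubS : ubound S t1 by move=> s [].
have hS : has_sup S by split; [exists a|exists t1].
have aS : a <= sup S by apply: ub_le_sup => //; exists t1.
have St1 : sup S <= t1 by apply: ge_sup => //; exists a.
have below u : a <= u -> u < sup S -> f u <= B u.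
  move=> au uS; have [|s [_ _ Ss] us] := @sup_adherent _ S (sup S - u) _ hS.
    by rewrite subr_gt0.
  by apply: Ss => //; apply: ltW; move: us; rewrite subKr.
have fsup : f (sup S) <= B (sup S).
  apply/ler_addgt0Pl => e e0.
  have := Bcont _ aS => /cvgrPdist_lt /(_ e e0) [d /= d0 Bd].
  have [->|/eqP aneS] := eqVneq (sup S) a; first by rewrite (le_trans fa)// lerDr ltW.
  have aS' : a < sup S by rewrite lt_neqAle aS andbT; apply/eqP => /esym.
  pose u := Num.max a (sup S - d / 2).
  have au : a <= u by rewrite le_max lexx.
  have uS : u < sup S by rewrite gt_max aS'/= ltrBlDr ltrDl divr_gt0.
  apply: (le_trans (fmono u _ au (ltW uS))); apply: (le_trans (below u au uS)).
  have : `|B (sup S) - B u| < e.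
    apply: Bd => /=; rewrite ger0_norm ?subr_ge0 ?ltW//.
    have : sup S - d / 2 <= u by rewrite le_max lexx orbT.
    lra.
  by rewrite ltr_norml => /andP[]; lra.
have St1' : sup S < t1.
  by rewrite lt_neqAle St1 andbT; apply/eqP => E; move: Bf; rewrite -E ltNge fsup.
have [d d0 dstep] := step _ aS fsup.
pose v := Num.min t1 (sup S + d / 2).
have Sv : sup S < v by rewrite lt_min St1'/= ltrDl divr_gt0.
suff /(ub_le_sup (ex_intro _ t1 ubS)) : S v by rewrite leNgt Sv.
split; first by rewrite (le_trans aS)// ltW.
  by rewrite ge_min lexx.
move=> u au uv; have [uS|] := ltP u (sup S); first exact: below.
rewrite le_eqVlt => /predU1P[<-//|Su]; apply: dstep => //.
have : v <= sup S + d / 2 by rewrite ge_min lexx orbT.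
lra.
Qed.

End ContinuousInduction.

Section Rate.
Variable R : realType.
Variables D t0 : R.
Hypotheses (D0 : 0 < D) (t00 : 0 < t0).

(** The exponential in the convergence bounds. *)
Definition decay s := expR (- D * (s - t0) + 2 * t0 * D * ln ((s + t0) / (2 * t0))).

(** Minus the logarithmic derivative of [decay]. *)
Definition decay_rate s := D * (s - t0) / (s + t0).

Lemma decay_t0 : decay t0 = 1.
Proof.
rewrite /decay subrr mulr0 add0r (_ : (t0 + t0) / (2 * t0) = 1).
  by rewrite ln1 mulr0 expR0.
by field; rewrite gt_eqF.
Qed.

(** The exponent is concave, so it lies below its tangent at [s], and the
    exponential lies above its tangent at 0. *)
Lemma decay_step t s : t0 <= t -> t <= s ->
  decay t * (1 - (s - t) * decay_rate s) <= decay s.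
Proof.
move=> t0t ts; have t0p := t00; have st0 : 0 < s + t0 by lra.
have tt0 : 0 < t + t0 by lra.
have h2 : 0 < 2 * t0 by rewrite mulr_gt0.
rewrite /decay -ler_pdivlMl ?expR_gt0// -expRN -expRD.
apply: le_trans (expR_ge1Dx _); rewrite lerD2l.
rewrite !ln_div ?posrE//.
have := relent_ge (ltW st0) tt0; rewrite ln_div ?posrE// => h.
have h3 : (s - t) / (s + t0) <= ln (s + t0) - ln (t + t0).
  by rewrite ler_pdivrMr//; lra.
have : 2 * t0 * D * ((s - t) / (s + t0)) <= 2 * t0 * D * (ln (s + t0) - ln (t + t0)).
  by rewrite ler_wpM2l// mulr_ge0 ?ltW.
have -> : 2 * t0 * D * ((s - t) / (s + t0)) = (s - t) * D - (s - t) * decay_rate s.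
  by rewrite /decay_rate; field; rewrite gt_eqF.
lra.
Qed.

Lemma continuous_decay t : t0 <= t -> {for t, continuous decay}.
Proof.
move=> t0t; rewrite /decay; have t0p := t00.
have tt0 : 0 < (t + t0) / (2 * t0) by rewrite divr_gt0 ?mulr_gt0//; lra.
have idc : (fun s : R => s) @ t --> t by exact: cvg_id.
apply: (@continuous_comp _ _ _
  (fun s : R => - D * (s - t0) + 2 * t0 * D * ln ((s + t0) / (2 * t0))) expR).
  apply: cvgD.
    by apply: cvgM; [exact: cvg_cst|apply: cvgB => //; exact: cvg_cst].
  apply: cvgM; first exact: cvg_cst.
  apply: (@continuous_comp _ _ _ (fun s : R => (s + t0) / (2 * t0)) (@ln R)).
    apply: cvgM; last exact: cvg_cst.
    by apply: cvgD => //; exact: cvg_cst.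
  exact: continuous_ln.
exact: continuous_expR.
Qed.

(** To first order in [h] the product exceeds 1 by [h] times the difference of the
    two rates.  This difference is at least [D * t0 / (2 * s)], which for small
    [h] outweighs the second order term. *)
Lemma rate_gap_same s h : t0 <= s -> 0 <= h -> h * (2 * D * s) <= t0 ->
  1 <= (1 + h * (D * (1 - t0 / (2 * s)))) * (1 - h * decay_rate s).
Proof.
move=> t0s h0 hh; have t0p := t00; have s0 : 0 < s by lra.
have st0 : 0 < s + t0 by lra.
rewrite /decay_rate -subr_ge0.
have -> : (1 + h * (D * (1 - t0 / (2 * s)))) * (1 - h * (D * (s - t0) / (s + t0))) - 1
  = h * D / (2 * s * (s + t0)) *
    (t0 * (3 * s - t0) - h * D * (2 * s - t0) * (s - t0)).
  by field; rewrite !gt_eqF.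
apply: mulr_ge0; first by rewrite divr_ge0 ?mulr_ge0// ltW.
have hD : 0 <= h * D by rewrite mulr_ge0// ltW.
have hDs : h * D * s <= t0 / 2 by lra.
have : h * D * (2 * s - t0) <= t0.
  have : 0 <= h * D * t0 by rewrite mulr_ge0// ltW.
  lra.
move: (h * D * (2 * s - t0)) => r r1.
have : r * (s - t0) <= t0 * (s - t0) by rewrite ler_wpM2r// subr_ge0.
have : 0 <= t0 * s by rewrite mulr_ge0// ltW.
nra.
Qed.

(** Since [D * (1 - t0 / (2 * t))] exceeds [decay_rate] strictly, there is room to
    evaluate [decay_rate] at a later time and to lose the factor
    [1 - t0 / (6 * t)] in [opt_gap_step]. *)
Lemma rate_gap_next t s : t0 <= t -> t <= s -> s <= 2 * t ->
  decay_rate s <= D * (1 - t0 / (2 * t)) * (1 - t0 / (6 * t)).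
Proof.
move=> t0t ts s2; have t0p := t00; have p : 0 < t by lra.
have h1 : decay_rate s <= D * (1 - 2 * t0 / (3 * t)).
  rewrite /decay_rate -[leLHS]mulrA ler_pM2l// ler_pdivrMr; last lra.
  have : 2 * t0 / (3 * t) * (s + t0) <= 2 * t0.
    rewrite mulrAC ler_pdivrMr ?mulr_gt0// ler_pM2l ?mulr_gt0//; lra.
  lra.
apply: (le_trans h1); rewrite -[leRHS]mulrA ler_pM2l//.
have r0 : 0 <= t0 / t by rewrite divr_ge0// ltW.
have -> : 2 * t0 / (3 * t) = 2 / 3 * (t0 / t) by field; rewrite gt_eqF.
have -> : t0 / (2 * t) = 1 / 2 * (t0 / t) by field; rewrite gt_eqF.
have -> : t0 / (6 * t) = 1 / 6 * (t0 / t) by field; rewrite gt_eqF.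
nra.
Qed.

(** It suffices to follow the bound over short times. *)
Lemma decay_induction (f : R -> R) C : 0 <= C -> f t0 <= C ->
  (forall s t, t0 <= s -> s <= t -> f t <= f s) ->
  (forall t, t0 <= t -> f t <= C * decay t ->
    exists2 d, 0 < d & forall s, t < s -> s < t + d ->
      f s <= C * decay t * (1 - (s - t) * decay_rate s)) ->
  forall t, t0 <= t -> f t <= C * decay t.
Proof.
move=> C0 fC fmono step; apply: continuous_induction => //.
- by rewrite decay_t0 mulr1.
- move=> t t0t; apply: cvgM; first exact: cvg_cst.
  exact: continuous_decay.
move=> t t0t ft; have [d d0 dstep] := step _ t0t ft.
exists d => // s ts sd; apply: (le_trans (dstep _ ts sd)).
by rewrite -mulrA ler_wpM2l// decay_step// ltW.
Qed.

End Rate.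

(** * Convergence of the regularized solutions *)

Section CentralPath.
Variables (R : realType) (X : finType).
Variables (c : vec R X) (P : set (vec R X)) (U : {vspace vec R X}).
Variable ms : vec R X.
Implicit Types (u v w mu nu : vec R X) (t s : R) (x : X).

Hypothesis PE : forall mu nu, P mu ->
  P nu <-> (forall x, 0 <= nu x) /\ nu - mu \in U.
Hypothesis U_sum0 : forall u, u \in U -> \sum_x (u x : R) = 0.
Hypothesis P_sum1 : forall mu, P mu -> \sum_x (mu x : R) = 1.
Hypothesis P_pos : exists p, P p /\ forall x, 0 < p x.
Hypothesis msP : P ms.
Hypothesis ms_max : forall nu, P nu -> dot c nu <= dot c ms.
Hypothesis ms_uniq : forall nu, P nu -> dot c nu = dot c ms -> nu = ms.

Let gap mu : R := dot c ms - dot c mu.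

Lemma gap_ge0 mu : P mu -> 0 <= gap mu.
Proof. by move=> Pmu; rewrite subr_ge0 ms_max. Qed.

(** The convexity inequality of the maximum of the objective as a function of the
    parameter; the divergence from [ms] is this function minus an affine one,
    with derivative [- gap]. *)
Lemma opt_kl_step t s mu mu' : reg_opt c P U t mu -> reg_opt c P U s mu' ->
  kl ms mu' <= kl ms mu - (s - t) * gap mu'.
Proof.
move=> ot os; rewrite (opt_kl PE ot msP) (opt_kl PE os msP).
have [Pmu' _ _] := os; have := opt_max PE P_sum1 ot Pmu'.
rewrite /reg_objective /gap; lra.
Qed.

Lemma opt_ln_diff t s mu mu' w : reg_opt c P U t mu -> reg_opt c P U s mu' ->
  w \in U ->
  (s - t) * dot c w = \sum_x (w x : R) * (ln (mu' x) - ln (mu x)).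
Proof.
move=> [_ _ ot] [_ _ os] wU; rewrite mulrBl os// ot// -sumrB.
by apply: eq_bigr => x _; rewrite mulrBr.
Qed.

Lemma opt_gap_diff t s mu mu' : reg_opt c P U t mu -> reg_opt c P U s mu' ->
  (s - t) * (gap mu - gap mu') =
  \sum_x ((mu' x : R) - mu x) * (ln (mu' x) - ln (mu x)).
Proof.
move=> /[dup] ot [Pmu _ _] /[dup] os [Pmu' _ _].
have -> : gap mu - gap mu' = dot c (mu' - mu) by rewrite /gap dotBr; ring.
rewrite (opt_ln_diff ot os (P_subU PE Pmu Pmu')).
by apply: eq_bigr => x _; rewrite vecBE.
Qed.

Lemma opt_coord_in01 t mu x : reg_opt c P U t mu -> 0 < (mu x : R) <= 1.
Proof.
by move=> [Pmu mu0 _]; rewrite mu0/= simplex_le1//; exact: (P_simplex PE).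
Qed.

Lemma opt_gap_nonincr t s mu mu' : t < s -> reg_opt c P U t mu -> reg_opt c P U s mu' ->
  gap mu' <= gap mu.
Proof.
move=> ts ot os; rewrite -subr_ge0 -(pmulr_rge0 _ (_ : 0 < s - t)) ?subr_gt0//.
rewrite (opt_gap_diff ot os); apply: sumr_ge0 => x _.
apply: (@le_trans _ _ (((mu' x : R) - mu x) ^+ 2)); first exact: sqr_ge0.
by apply: sqr_diff_le_diff_ln; [exact: opt_coord_in01 ot|exact: opt_coord_in01 os].
Qed.

(** Comparing the first order conditions in the direction [mu' - mu] bounds the
    squared distance by [(s - t) * dot c (mu' - mu)]. *)
Lemma opt_lipschitz t s mu mu' x : t < s ->
  reg_opt c P U t mu -> reg_opt c P U s mu' ->
  `|(mu' x : R) - mu x| <= (1 + dot c c) * (s - t).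
Proof.
move=> ts ot os; have h0 : 0 < s - t by rewrite subr_gt0.
have S0 : 0 <= dot c c by apply: sumr_ge0 => y _; rewrite -expr2 sqr_ge0.
pose d y : R := (mu' y : R) - mu y.
have sumd : \sum_y d y ^+ 2 <= (s - t) ^+ 2 * dot c c.
  have h1 : \sum_y d y ^+ 2 <= (s - t) * dot c (mu' - mu).
    have := opt_gap_diff ot os.
    have -> : gap mu - gap mu' = dot c (mu' - mu) by rewrite /gap dotBr; ring.
    move=> ->; apply: ler_sum => y _; apply: sqr_diff_le_diff_ln.
      exact: opt_coord_in01 ot.
    exact: opt_coord_in01 os.
  have h2 : 2 * ((s - t) * dot c (mu' - mu)) <=
      (s - t) ^+ 2 * dot c c + \sum_y d y ^+ 2.
    rewrite /dot !mulr_sumr -big_split/=; apply: ler_sum => y _.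
    rewrite vecBE -/(d y); have := sqr_ge0 ((s - t) * (c y : R) - d y).
    by move: (c y : R) (d y) => a b; nra.
  by lra.
rewrite -(@ler_pXn2r _ 2) ?nnegrE//; last first.
  by apply: mulr_ge0; [exact: addr_ge0|exact: ltW].
rewrite real_normK ?num_real//.
have : d x ^+ 2 <= \sum_y d y ^+ 2.
  by rewrite (bigD1 x)//= lerDl sumr_ge0// => y _; rewrite sqr_ge0.
have : 0 <= (s - t) ^+ 2 by rewrite sqr_ge0.
rewrite -/(d x) exprMn => hh dx.
apply: (le_trans dx); apply: (le_trans sumd).
by rewrite mulrC ler_wpM2r//; move: S0; move: (dot c c) => S S0; nra.
Qed.

(** Cauchy-Schwarz in discrete form.  With [l = ln mu' - ln mu], the number
    [(s - t) * gap mu] is the pairing of [ms - mu] with [l], and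
    [(s - t) * (gap mu - gap mu')] dominates the square of [l] weighted by
    [eta * mu]. *)
Lemma opt_gap_step t s (lam eta : R) mu mu' : t < s -> 0 < lam -> 0 < eta <= 1 ->
  reg_opt c P U t mu -> reg_opt c P U s mu' ->
  (forall x, eta * (mu x : R) <= mu' x) ->
  \sum_x ((ms x : R) - mu x) ^+ 2 / mu x <= gap mu / lam ->
  gap mu' <= gap mu * (1 - (s - t) * (lam * eta)).
Proof.
move=> ts lam0 /andP[eta0 eta1] ot os etamu chi.
have [Pmu mu0 _] := ot; have [Pmu' mu0' _] := os.
have h0 : 0 < s - t by rewrite subr_gt0.
pose kap := (s - t) * lam * eta.
have kap0 : 0 < kap by rewrite !mulr_gt0.
pose l x := ln (mu' x) - ln (mu x).
have E1 : (s - t) * gap mu = \sum_x ((ms x : R) - mu x) * l x.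
  have := opt_ln_diff ot os (P_subU PE Pmu msP); rewrite dotBr => ->.
  by apply: eq_bigr => x _; rewrite vecBE.
have E2 := opt_gap_diff ot os.
have : 2 * ((s - t) * gap mu) <= kap / eta *
    (\sum_x ((ms x : R) - mu x) ^+ 2 / mu x) +
    ((s - t) * (gap mu - gap mu')) / kap.
  rewrite E1 E2 mulr_suml !mulr_sumr -big_split/=; apply: ler_sum => x _.
  have := @mul_diff_ln_ge R (eta * mu x) (mu x) (mu' x).
  have em0 : 0 < eta * (mu x : R) by rewrite mulr_gt0.
  have em1 : eta * (mu x : R) <= mu x by rewrite ler_piMl// ltW.
  move=> /(_ em0 em1 (etamu x)).
  rewrite -/(l x); move: (mu0 x) (l x) => m0 lx hl.
  have ik0 : 0 < kap^-1 by rewrite invr_gt0.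
  rewrite -(ler_pM2r ik0) in hl.
  apply: le_trans (lerD (lexx _) hl).
  rewrite -subr_ge0.
  have -> : kap / eta * (((ms x : R) - mu x) ^+ 2 / mu x) +
     eta * (mu x : R) * lx ^+ 2 / kap - 2 * (((ms x : R) - mu x) * lx) =
     (kap * ((ms x : R) - mu x) - eta * (mu x : R) * lx) ^+ 2 /
       (kap * eta * mu x).
    by field; rewrite !gt_eqF.
  by rewrite divr_ge0 ?sqr_ge0// ltW// !mulr_gt0.
have le1 : kap / eta * (\sum_x ((ms x : R) - mu x) ^+ 2 / mu x) <=
    (s - t) * gap mu.
  rewrite (_ : (s - t) * gap mu = kap / eta * (gap mu / lam)).
    by rewrite ler_pM2l// divr_gt0.
  by rewrite /kap; field; rewrite !gt_eqF.
have -> : (s - t) * (gap mu - gap mu') / kap = (gap mu - gap mu') / (lam * eta).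
  by rewrite /kap; field; rewrite !gt_eqF.
move=> h; have : (s - t) * gap mu <= (gap mu - gap mu') / (lam * eta) by lra.
by rewrite ler_pdivlMr ?mulr_gt0//; lra.
Qed.

Lemma entropy_range_ge mu nu : P mu -> P nu ->
  entropy mu - entropy nu <= entropy_range P.
Proof.
move=> Pmu Pnu; rewrite /entropy_range lerB//.
  apply: ub_le_sup; last by exists mu.
  by exists (ln #|X|%:R) => _ [la Pla <-]; apply: entropy_le_lncard; exact: (P_simplex PE).
apply: ge_inf; last by exists nu.
by exists 0 => _ [la Pla <-]; apply: entropy_ge0; exact: (P_simplex PE).
Qed.

Lemma entropy_range_le : entropy_range P <= ln #|X|%:R.
Proof.
rewrite /entropy_range -[leRHS]subr0 lerB//.
  apply: ge_sup; first by exists (entropy ms), ms.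
  by move=> _ [la Pla <-]; apply: entropy_le_lncard; exact: (P_simplex PE).
apply: lb_le_inf; first by exists (entropy ms), ms.
by move=> _ [la Pla <-]; apply: entropy_ge0; exact: (P_simplex PE).
Qed.

Lemma opt0_kl mu0 : reg_opt c P U 0 mu0 -> kl ms mu0 = entropy mu0 - entropy ms.
Proof. by move=> o0; rewrite (opt_kl PE o0 msP) /reg_objective !mul0r !add0r. Qed.

Lemma opt0_entropy_max mu0 nu : reg_opt c P U 0 mu0 -> P nu ->
  entropy nu <= entropy mu0.
Proof. by move=> o0 /(opt_max PE P_sum1 o0); rewrite /reg_objective !mul0r !add0r. Qed.

(** The optimum at [t] is better than [ms], and [H] is largest at [mu0]. *)
Lemma opt_gap_le_kl t mu mu0 : reg_opt c P U t mu -> reg_opt c P U 0 mu0 ->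
  t * gap mu <= kl ms mu0.
Proof.
move=> /[dup] ot [Pmu _ _] o0; rewrite (opt0_kl o0).
have := opt0_entropy_max o0 Pmu; have := opt_max PE P_sum1 ot msP.
by rewrite /reg_objective /gap; lra.
Qed.

(** Prolong the segment from [ms] through [mu] up to the boundary of [P]: at its
    end [nu] a coordinate [y] with [ms y > 0] vanishes, and
    [mu = sg * ms + (1 - sg) * nu].  Along the segment the slope of the entropy
    at [mu], times the distance to [ms], is [t * gap mu].  The coordinate [y]
    contributes [ms y * (- ln sg - (1 - sg))] to the gain beyond the tangent, and
    by [entropy_mix] it makes the entropy between [mu] and [nu] exceed the
    chord; [ray_tradeoff] combines the two. *)
Lemma opt_gap_entropy_range t (m : R) mu mu0 : 0 <= t ->
  reg_opt c P U t mu -> reg_opt c P U 0 mu0 ->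
  0 < m -> (forall x, 0 < (ms x : R) -> m <= ms x) ->
  m * (t * gap mu) <= 2 * kl ms mu0 * entropy_range P.
Proof.
move=> t_ge0 ot o0 m0 mms; have [Pmu mu_gt0 fo] := ot; have [Pmu0 mu0_gt0 _] := o0.
have K0 : 0 <= kl ms mu0.
  exact: kl_ge0 (fun x => P_ge0 PE x msP) mu0_gt0 (P_sum_eq P_sum1 msP Pmu0).
have KR : kl ms mu0 <= entropy_range P by rewrite (opt0_kl o0) entropy_range_ge.
have [mums|mums] := eqVneq mu ms.
  rewrite mums /gap subrr !mulr0; apply: mulr_ge0; first exact: mulr_ge0.
  exact: le_trans KR.
have [|x1] := @exists_neg_coord R X U U_sum0 (mu - ms) (P_subU PE msP Pmu).
  by rewrite subr_eq0.
rewrite vecBE subr_lt0 => mu1.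
have ms1 : 0 < (ms x1 : R) by exact: lt_trans mu1.
have [y /= msy ymin] := @exists_argmin R X [pred x | 0 < (ms x : R)]
  (fun x => (mu x : R) / ms x) x1 ms1.
set p : R := ms y in msy *; set sg := (mu y : R) / p in ymin.
have sg1 : sg < 1.
  by apply: (le_lt_trans (ymin _ ms1)); rewrite ltr_pdivrMr// mul1r.
have sg0 : 0 < sg by rewrite divr_gt0.
have muy : (mu y : R) = p * sg by rewrite /sg mulrC divfK// gt_eqF.
pose nu := (1 - sg)^-1 *: (mu - sg *: ms).
have nuE x : (nu x : R) = (1 - sg)^-1 * ((mu x : R) - sg * ms x).
  by rewrite !ffunE.
have Pnu : P nu.
  apply/(PE _ msP); split=> [x|].
    rewrite nuE; apply: mulr_ge0; first by rewrite invr_ge0 subr_ge0 ltW.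
    rewrite subr_ge0; have := P_ge0 PE x msP; rewrite le_eqVlt.
    move=> /predU1P[<-|msx]; first by rewrite mulr0 ltW.
    by have := ymin x msx; rewrite ler_pdivlMr.
  have -> : nu - ms = (1 - sg)^-1 *: (mu - ms).
    have combo (a b : R) : (1 - sg)^-1 * (a - sg * b) - b = (1 - sg)^-1 * (a - b).
      by field; rewrite subr_eq0 gt_eqF.
    by apply/ffunP => x; rewrite !ffunE; exact: combo.
  by apply: memvZ; exact: (P_subU PE msP Pmu).
have nuy : nu y = 0.
  by apply: (etrans (nuE y)); rewrite muy -/p mulrC [p * _]mulrC subrr mul0r.
have yE : t * gap mu = \sum_x ((ms x : R) - mu x) * ln (mu x).
  have := fo _ (P_subU PE Pmu msP); rewrite dotBr => ->.
  by apply: eq_bigr => x _; rewrite vecBE.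
have y0 : 0 <= t * gap mu by rewrite mulr_ge0// gap_ge0.
apply: (@le_trans _ _ (p * (t * gap mu))); first by rewrite ler_wpM2r// mms.
have gE := entropy_sub (fun x => P_ge0 PE x msP) mu_gt0.
have Hmax nu' : P nu' -> entropy nu' <= kl ms mu0 + entropy ms.
  by move=> Pnu'; rewrite (opt0_kl o0) subrK; exact: opt0_entropy_max.
apply: (@ray_tradeoff R p _ (entropy mu - entropy ms) _ _ sg) => //.
- by rewrite sg0 ltW.
- by have := Hmax _ Pmu; lra.
- rewrite gE -yE addrC lerD2r.
  have := kl_ge_term y (fun x => P_ge0 PE x msP) mu_gt0 (P_sum_eq P_sum1 msP Pmu).
  apply: le_trans; rewrite muy -/p.
  have -> : p / (p * sg) = sg^-1 by rewrite invfM mulrA divff ?mul1r// gt_eqF.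
  by rewrite lnV ?posrE//; lra.
- move=> q /[dup] q01 /andP[q0 q1].
  have Ppi : P (q *: mu + (1 - q) *: nu) by apply: (P_convex PE) => //; rewrite q1 ltW.
  have hmix := entropy_mix (fun z => P_ge0 PE z Pmu) (fun z => P_ge0 PE z Pnu) q01 nuy.
  have h1 := Hmax _ Ppi.
  have h2 := entropy_range_ge Pmu0 Pnu.
  have h3 := opt0_kl o0.
  have h4 : (1 - q) * (entropy mu0 - entropy nu) <= (1 - q) * entropy_range P.
    by rewrite ler_wpM2l// subr_ge0.
  rewrite muy in hmix; rewrite -(ler_pM2l q0).
  have -> : q * (kl ms mu0 + (q^-1 - 1) * entropy_range P + p * sg * ln q) =
      q * kl ms mu0 + (1 - q) * entropy_range P + q * (p * sg * ln q).
    by field; rewrite gt_eqF.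
  rewrite h3 in h1 *; move: hmix h1 h4 => {h2 h3}.
  move: (entropy mu) (entropy nu) (entropy mu0) (entropy ms) (entropy (_ + _)).
  move=> Hmu Hnu H0 Hms Hpi hmix h1 h4.
  have -> : q * (p * sg * ln q) = q * (p * sg) * ln q by ring.
  by lra.
Qed.

Hypothesis P_other : exists2 mu, P mu & mu <> ms.

Let D : R := edge_gap c P ms.
Let mu0 := max_entropy_sol P.
Let K0 : R := kl ms mu0.
Let m : R := min_positive_entry ms.
Let t0 : R := 2 * K0 / (D * m).
Let RH : R := entropy_range P.

Lemma min_positive_entry_le x : 0 < (ms x : R) -> m <= ms x.
Proof.
move=> msx; apply: ge_inf; last by exists x.
by exists 0 => _ [y /= msy <-]; exact: ltW.
Qed.

Lemma min_positive_entry_gt0 : 0 < m.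
Proof.
have [|e e0 he] := @exists_pos_lower_bound R X (fun x => 0 < (ms x : R)) (fun x => ms x) => //.
apply: (lt_le_trans e0); apply: lb_le_inf; last by move=> _ [x /= msx <-]; exact: he.
apply: contrapT => nx; have := P_sum1 msP; rewrite big1 => [/esym/eqP|x _].
  by rewrite oner_eq0.
apply/eqP; rewrite eq_le (P_ge0 PE _ msP) andbT leNgt; apply/negP => msx.
by apply: nx; exists (ms x), x.
Qed.

(** Otherwise every direction of [P] would be tangent at [ms], along with its
    opposite. *)
Lemma exists_zero_coord : exists x, ms x = 0.
Proof.
have [mu Pmu mums] := P_other; apply: contrapT => nx.
have mU := P_subU PE msP Pmu.
have T v : v \in U -> tangent U ms v by move=> vU; split=> // x mx; case: nx; exists x.
have v0 : mu - ms != 0 by rewrite subr_eq0; apply/eqP.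
have := tangent_dot_lt0 PE msP ms_max ms_uniq (T _ mU) v0.
have := tangent_dot_lt0 PE msP ms_max ms_uniq (T (- (mu - ms)) _).
rewrite rpredN oppr_eq0 dotNr => /(_ mU v0); lra.
Qed.

Lemma edge_gap_pos : 0 < D.
Proof.
have [mu Pmu mums] := P_other.
apply: (edge_gap_gt0 PE msP ms_max ms_uniq P_sum1).
exact: (neighbor_exists PE U_sum0 msP ms_max ms_uniq Pmu mums).
Qed.

Lemma opt_mu0 : reg_opt c P U 0 mu0.
Proof. exact: max_entropy_opt. Qed.

(** Where [ms] vanishes [mu0] does not, and this coordinate alone contributes
    [mu0 x]. *)
Lemma K0_gt0 : 0 < K0.
Proof.
have [x msx] := exists_zero_coord; have [Pmu0 mu0_gt0 _] := opt_mu0.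
have := kl_ge_term x (fun x => P_ge0 PE x msP) mu0_gt0 (P_sum_eq P_sum1 msP Pmu0).
rewrite msx !mul0r !sub0r opprK; exact: lt_le_trans.
Qed.

Lemma t0_gt0 : 0 < t0.
Proof.
by rewrite divr_gt0// mulr_gt0// ?K0_gt0 ?edge_gap_pos ?min_positive_entry_gt0.
Qed.

Lemma K0E : K0 = t0 * D * m / 2.
Proof.
rewrite /t0; field.
by rewrite !gt_eqF ?edge_gap_pos ?min_positive_entry_gt0.
Qed.

Lemma K0_le_RH : K0 <= RH.
Proof.
have [Pmu0 _ _] := opt_mu0.
by rewrite /K0 (opt0_kl opt_mu0); exact: entropy_range_ge.
Qed.

Lemma RH_ge0 : 0 <= RH.
Proof. exact: le_trans (ltW K0_gt0) K0_le_RH. Qed.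

Lemma damping_bounds t : t0 <= t -> [/\ 0 < t, 0 < 1 - t0 / (2 * t) &
  1 - t0 / (2 * t) <= 1].
Proof.
move=> t0t; have t00 := t0_gt0; have p : 0 < t by lra.
have : 0 < t0 / (2 * t) by rewrite divr_gt0// mulr_gt0.
have : t0 / (2 * t) <= 1 / 2.
  by rewrite ler_pdivrMr ?mulr_gt0//; lra.
by move=> h1 h2; split=> //; lra.
Qed.

(** From [D * tv_norm <= gap <= K0 / t] and the choice of [t0], no coordinate is
    off by more than [t0 / (2 * t)] times the least positive entry of [ms]. *)
Lemma opt_ratio t mu x : t0 <= t -> reg_opt c P U t mu ->
  (1 - t0 / (2 * t)) * (ms x : R) <= mu x.
Proof.
move=> t0t ot; have [p _ _] := damping_bounds t0t.
have [Pmu mu_gt0 _] := ot; have D0 := edge_gap_pos.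
have := P_ge0 PE x msP; rewrite le_eqVlt => /predU1P[<-|msx].
  by rewrite mulr0 ltW.
have h1 := opt_gap_le_kl ot opt_mu0.
have h2 := gap_ge_tv PE U_sum0 msP ms_max ms_uniq P_sum1 Pmu.
have h3 : `|(ms - mu) x : R| <= tv_norm (ms - mu).
  by apply: coord_le_tv; exact: U_sum0 (P_subU PE Pmu msP).
have h4 := min_positive_entry_le msx.
have h5 : tv_norm (ms - mu) <= t0 / (2 * t) * m.
  rewrite -(ler_pM2l D0); apply: (le_trans h2).
  rewrite -(ler_pM2l p) -/(gap mu); apply: (le_trans h1).
  by rewrite -/K0 K0E le_eqVlt; apply/orP; left; apply/eqP; field; rewrite gt_eqF.
have h6 : t0 / (2 * t) * m <= t0 / (2 * t) * (ms x : R).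
  rewrite ler_wpM2l//; apply: divr_ge0; first exact: ltW t0_gt0.
  by apply: mulr_ge0 => //; exact: ltW.
have := ler_norm ((ms - mu) x : R); rewrite vecBE in h3 *; lra.
Qed.

Lemma opt_chi2 t mu : t0 <= t -> reg_opt c P U t mu ->
  \sum_x ((ms x : R) - mu x) ^+ 2 / mu x <= gap mu / (D * (1 - t0 / (2 * t))).
Proof.
move=> t0t ot; have [p th0 _] := damping_bounds t0t.
have [Pmu mu_gt0 _] := ot; have D0 := edge_gap_pos.
apply: le_trans (chi2_le_tv th0 (fun x => P_ge0 PE x msP) mu_gt0
  (fun x => opt_ratio x t0t ot) (P_sum_eq P_sum1 msP Pmu)) _.
move: (1 - _) th0 => th th0.
rewrite invfM [leRHS]mulrA ler_pM2r ?invr_gt0// ler_pdivlMr// mulrC.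
exact: (gap_ge_tv PE U_sum0 msP ms_max ms_uniq P_sum1 Pmu).
Qed.

Lemma opt_kl_le_gap t mu : t0 <= t -> reg_opt c P U t mu ->
  D * (1 - t0 / (2 * t)) * kl ms mu <= gap mu.
Proof.
move=> t0t ot; have [p th0 _] := damping_bounds t0t.
have [Pmu mu_gt0 _] := ot; have D0 := edge_gap_pos.
rewrite mulrC -ler_pdivlMr ?mulr_gt0//; apply: le_trans (opt_chi2 t0t ot).
exact: kl_le_chi2 (fun x => P_ge0 PE x msP) mu_gt0 (P_sum_eq P_sum1 msP Pmu).
Qed.

Let sol t := reg_sol c P t.

Lemma opt_sol t : t0 <= t -> reg_opt c P U t (sol t).
Proof. by move=> t0t; apply: reg_sol_opt => //; have := t0_gt0; lra. Qed.

(** In a step from [t] to [s] the divergence drops by at least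
    [(s - t) * gap (sol s)], which [opt_kl_le_gap] bounds from below by a multiple
    of the divergence at [s]. *)
Lemma kl_decay t : t0 <= t -> kl ms (sol t) <= RH * decay D t0 t.
Proof.
have t00 := t0_gt0; have D0 := edge_gap_pos; have RH0 := RH_ge0.
move: t; apply: (@decay_induction R D t0 D0 t00 (fun t => kl ms (sol t))) => //.
- have ot := opt_sol (lexx t0); have [Pmu _ _] := ot.
  have := opt_kl_step opt_mu0 ot; rewrite subr0 -/K0.
  have : 0 <= t0 * gap (sol t0) by rewrite mulr_ge0 ?gap_ge0// ltW.
  have := K0_le_RH; lra.
- move=> s t t0s st; have os := opt_sol t0s; have ot := opt_sol (le_trans t0s st).
  have [Pmu _ _] := ot; have := opt_kl_step os ot.
  have : 0 <= (t - s) * gap (sol t) by rewrite mulr_ge0 ?gap_ge0// subr_ge0.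
  lra.
move=> t t0t ft; have t_gt0 : 0 < t by lra.
(* short enough for rate_gap_same, as s <= t + 1 *)
pose d := Num.min 1 (t0 / (2 * D * (t + 1))).
have dden : 0 < 2 * D * (t + 1) by rewrite !mulr_gt0//; lra.
exists d; first by rewrite lt_min ltr01/= divr_gt0.
move=> s ts sd; have t0s : t0 <= s by lra.
have [h1 h2] : s - t <= 1 /\ s - t <= t0 / (2 * D * (t + 1)).
  have : s - t <= d by lra.
  by rewrite le_min => /andP[].
have hh : (s - t) * (2 * D * s) <= t0.
  rewrite ler_pdivlMr// in h2; apply: le_trans h2.
  by rewrite ler_wpM2l ?subr_ge0 ?(ltW ts)// ler_pM2l ?mulr_gt0//; lra.
have h0 : 0 <= s - t by lra.
have rg := rate_gap_same D0 t00 t0s h0 hh.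
have os := opt_sol t0s; have ot := opt_sol t0t.
have step := opt_kl_step ot os.
have lo := opt_kl_le_gap t0s os.
set lam := D * (1 - t0 / (2 * s)) in rg lo.
have lam0 : 0 < lam by rewrite mulr_gt0//; case: (damping_bounds t0s).
have pos : 0 < 1 + (s - t) * lam.
  by rewrite ltr_pwDl// mulr_ge0// ltW.
rewrite -(ler_pM2l pos); apply: (@le_trans _ _ (kl ms (sol t))).
  have : (s - t) * (lam * kl ms (sol s)) <= (s - t) * gap (sol s).
    by rewrite ler_wpM2l.
  lra.
apply: (le_trans ft); rewrite mulrCA -[leLHS]mulr1 ler_wpM2l//.
by rewrite mulr_ge0// ltW// expR_gt0.
Qed.

(** In a short step the solution changes by a small relative amount, so that
    [opt_gap_step] applies with [eta] close to 1; [opt_gap_entropy_range] provides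
    the initial bound. *)
Lemma gap_decay t : t0 <= t -> gap (sol t) <= D * RH * decay D t0 t.
Proof.
have t00 := t0_gt0; have D0 := edge_gap_pos; have RH0 := RH_ge0.
have m0 := min_positive_entry_gt0.
move: t; apply: (@decay_induction R D t0 D0 t00 (fun t => gap (sol t))) => //.
- by rewrite mulr_ge0// ltW.
- have ot := opt_sol (lexx t0).
  have := opt_gap_entropy_range (ltW t00) ot opt_mu0 m0 min_positive_entry_le.
  rewrite -/RH -/K0 K0E.
  have -> : 2 * (t0 * D * m / 2) * RH = m * (t0 * (D * RH)) by field.
  by rewrite ler_pM2l// ler_pM2l.
- move=> s t t0s; rewrite le_eqVlt => /predU1P[<-//|st].
  apply: (opt_gap_nonincr st); apply: opt_sol => //; lra.
move=> t t0t ft; have t_gt0 : 0 < t by lra.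
have ot := opt_sol t0t; have [Pmu mu_gt0 _] := ot.
(* e bounds the coordinates at t from below; until t + d they move by at most
   the fraction t0 / 6t of e *)
have [e e0 he] : exists2 e, 0 < e & forall x, true -> e <= (sol t x : R).
  exact: (@exists_pos_lower_bound R X xpredT (fun x => sol t x)).
have C0 : 0 < 1 + dot c c.
  by rewrite ltr_pwDl// sumr_ge0// => y _; rewrite -expr2 sqr_ge0.
pose d := Num.min (Num.min t D^-1) (t0 / (6 * t) * e / (1 + dot c c)).
have r0 : 0 < t0 / (6 * t) by rewrite divr_gt0// mulr_gt0.
exists d.
  by rewrite !lt_min t_gt0 invr_gt0 D0 !divr_gt0// mulr_gt0.
move=> s ts sd; have t0s : t0 <= s by lra.
have [h1 h2 h3] : [/\ s - t <= t, s - t <= D^-1 &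
    s - t <= t0 / (6 * t) * e / (1 + dot c c)].
  have : s - t <= d by lra.
  by rewrite !le_min => /andP[/andP[]].
have os := opt_sol t0s.
pose eta := 1 - t0 / (6 * t).
have r1 : t0 / (6 * t) <= 1 / 6 by rewrite ler_pdivrMr ?mulr_gt0//; lra.
have eta01 : 0 < eta <= 1 by apply/andP; split; rewrite /eta; lra.
have [_ th0 th1] := damping_bounds t0t.
have etamu x : eta * (sol t x : R) <= sol s x.
  have := opt_lipschitz x ts ot os; rewrite ler_pdivlMr// in h3.
  have := ler_norm (- ((sol s x : R) - sol t x)); rewrite normrN => a1 a2.
  have : t0 / (6 * t) * e <= t0 / (6 * t) * (sol t x : R).
    by rewrite ler_pM2l// he.
  by rewrite /eta; lra.
have lam0 : 0 < D * (1 - t0 / (2 * t)) by rewrite mulr_gt0.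
have := opt_gap_step ts lam0 eta01 ot os etamu (opt_chi2 t0t ot).
have rg : decay_rate D t0 s <= D * (1 - t0 / (2 * t)) * eta.
  by apply: rate_gap_next => //; lra.
have rD : D * (1 - t0 / (2 * t)) * eta <= D.
  rewrite -mulrA -[leRHS]mulr1 ler_pM2l//.
  by case/andP: eta01 => q0 q1; rewrite mulr_ile1// ltW.
set r := D * (1 - t0 / (2 * t)) * eta in rg rD * => hstep.
apply: (le_trans hstep).
have hr : (s - t) * r <= 1.
  have : (s - t) * r <= (s - t) * D by rewrite ler_wpM2l// subr_ge0 ltW.
  have : (s - t) * D <= 1 by rewrite -ler_pdivlMr// mul1r.
  lra.
apply: (@le_trans _ _ (D * RH * decay D t0 t * (1 - (s - t) * r))).
  by rewrite ler_wpM2r// subr_ge0.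
rewrite ler_wpM2l ?mulr_ge0 ?(ltW D0) ?(ltW (expR_gt0 _))//.
by rewrite lerB// ler_wpM2l// subr_ge0 ltW.
Qed.

End CentralPath.

(** The directions of [P] are those of [L] whose coordinates sum to 0. *)
Lemma simplex_affine_standard (R : realType) (X : finType)
    (L P : set (vec R X)) : affine_space L -> P = @simplex R X `&` L ->
  exists U : {vspace vec R X},
    (forall mu nu, P mu -> P nu <-> (forall x, 0 <= nu x) /\ nu - mu \in U) /\
    (forall u, u \in U -> \sum_x (u x : R) = 0).
Proof.
move=> [v [U ->]] ->; pose one : vec R X := [ffun=> 1 : R^o].
have oneE u : dot one u = \sum_x (u x : R).
  by apply: eq_bigr => x _; rewrite ffunE mul1r.
exists (U :&: orth one)%VS; split=> [mu nu|u]; last first.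
  by rewrite memv_cap mem_orth oneE => /andP[_ /eqP].
move=> [[mu0 mu1] [u /= uU muE]]; split.
  move=> [[nu0 nu1] [u' /= u'U nuE]]; split=> //.
  rewrite memv_cap mem_orth dotBr !oneE nu1 mu1 subrr eqxx andbT -muE -nuE.
  by rewrite opprD addrACA subrr add0r memvB.
move=> [nu0]; rewrite memv_cap mem_orth dotBr !oneE => /andP[dU].
rewrite subr_eq0 => /eqP s1; split.
  by split=> //; rewrite [LHS]s1.
exists (u + (nu - mu)); first exact: memvD.
by rewrite addrA muE addrC subrK.
Qed.

Theorem corollary3p3 (R : realType) (X : finType) (c : vec R X)
    (L P : set (vec R X)) (mustar : vec R X)
    (hL : affine_space L)
    (hP : P = @simplex R X `&` L)
    (hpos : exists mu, P mu /\ forall x, 0 < mu x)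
    (hsol : argmax P (dot c) = [set mustar])
    (hneq : P <> [set mustar]) :
  let mu0 := max_entropy_sol P in
  let Delta := edge_gap c P mustar in
  let t0 := 2 * kl mustar mu0 / (Delta * min_positive_entry mustar) in
  let RH := entropy_range P in
  RH <= ln (#|X|%:R : R) /\
  forall t : R, t0 <= t ->
    let bound := expR (- Delta * (t - t0)
                       + 2 * t0 * Delta * ln ((t + t0) / (2 * t0))) in
    kl mustar (reg_sol c P t) <= RH * bound /\
    dot c mustar - dot c (reg_sol c P t) <= Delta * RH * bound.
Proof.
have [U [PE U_sum0]] := simplex_affine_standard hL hP.
have P_sum1 mu : P mu -> \sum_x (mu x : R) = 1 by rewrite hP => -[[_ ->]].
have [Pms ms_max] : argmax P (dot c) mustar by rewrite hsol.
have ms_uniq nu : P nu -> dot c nu = dot c mustar -> nu = mustar.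
  move=> Pnu cnu; suff : argmax P (dot c) nu by rewrite hsol.
  by split=> // la Pla; rewrite cnu ms_max.
have P_other : exists2 mu, P mu & mu <> mustar.
  apply: contrapT => nP; apply: hneq; apply/seteqP; split=> [mu Pmu|_ ->//].
  by apply: contrapT => mums; apply: nP; exists mu.
split; first exact: (entropy_range_le PE P_sum1 Pms).
move=> t t0t; split.
- exact: (kl_decay PE U_sum0 P_sum1 hpos Pms ms_max ms_uniq P_other t0t).
- exact: (gap_decay PE U_sum0 P_sum1 hpos Pms ms_max ms_uniq P_other t0t).
Qed.
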